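(* Let $k$ be an algebraically closed field, $A=kQ$ the path algebra of a finite quiver $Q$, $T$ a finite-dimensional left $A$-module with dimension vector $t=\underline{\dim}\,T$, and $A[T]$ the one-point extension of $A$ by $T$. Let $(s,d)\in\mathbb N\times\mathbb N^{Q_0}$. For every point $\tilde M=(M,V,f:T\otimes_kV\to M)\in\mathrm{Rep}_{(s,d)}(A[T])$, the Zariski tangent space satisfies \[ \dim\mathsf T_{\tilde M}\mathrm{Rep}_{(s,d)}(A[T])=\dim\mathrm{Rep}_d(Q)+s\cdot\langle t,d\rangle_Q+\dim\mathrm{Ext}^1_A(\ker f,M). \]
   Context: $A[T]$ is the $k$-algebra of formal matrices $\begin{pmatrix} a & t\\ 0&\lambda\end{pmatrix}$ with $a\in A$, $t\in T$, $\lambda\in k$, with componentwise addition and formal matrix multiplication. Left $A[T]$-modules are identified with triples $(M,V,f)$, $M$ a left $A$-module, $V$ a $k$-vector space, $f:T\otimes_kV\to M$ $A$-linear; the dimension vector is $(\dim V,\underline{\dim}\,M)$. $A[T]\cong k\hat Q/(\mathrm{Rel})$, where $\hat Q$ is obtained from $Q$ by adding a vertex $\infty$ and arrows $\rho_{l,(i)}:\infty\to i$ for $i\in Q_0$, $l=1,\dots,\dim T_i$ (corresponding to a basis $\rho_{1,(i)},\dots,\rho_{\dim T_i,(i)}$ of $T_i$), and the relations are $\alpha\rho_{l,(i)}=\sum_{m}\lambda^{(\alpha)}_{m,l}\rho_{m,(j)}$ for each arrow $\alpha:i\to j$ of $Q$ and each $l$, where $T(\alpha)\rho_{l,(i)}=\sum_m\lambda^{(\alpha)}_{m,l}\rho_{m,(j)}$.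 $\mathrm{Rep}_d(Q)=\prod_{(\alpha:i\to j)\in Q_1}\mathrm{Hom}_k(k^{d_i},k^{d_j})$, similarly $\mathrm{Rep}_{(s,d)}(\hat Q)$ (with dimension $s$ at $\infty$), and $\mathrm{Rep}_{(s,d)}(A[T])\subseteq\mathrm{Rep}_{(s,d)}(\hat Q)$ is the closed subvariety (scheme) cut out by the relations. Its Zariski tangent space at $\tilde M$ is $\mathrm{Der}_{\tilde R}(A[T],\mathrm{End}_{\tilde R}(\tilde M))$, the space of derivations $A[T]\to\mathrm{End}_k(\tilde M)$ vanishing on the subalgebra $\tilde R$ spanned by the vertex idempotents of $\hat Q$. $\langle d,e\rangle_Q=\sum_{i\in Q_0}d_ie_i-\sum_{(\alpha:i\to j)\in Q_1}d_ie_j$. *)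

(* Defs.v *)
From HB Require Import structures.
From mathcomp Require Import all_boot all_order all_algebra.
From mathcomp Require Import finmap.
From mathcomp.multinomials Require Import monalg.

Set Implicit Arguments.
Unset Strict Implicit.
Unset Printing Implicit Defensive.

Import GRing.Theory VectorInternalTheory.
Local Open Scope ring_scope.

Record quiver := Quiver {
  vertex : finType;
  arrow : finType;
  src : arrow -> vertex;
  tgt : arrow -> vertex }.

Section LinearExtension.
Variables (k : fieldType) (K : choiceType) (W : lmodType k).

Definition lext (phi : K -> W) (g : {malg k[K]}) : W :=
  \sum_(x <- msupp g) g@_x *: phi x.

Lemma lextw (phi : K -> W) (g : {malg k[K]}) (D : {fset K}) :
  (msupp g `<=` D)%fset -> lext phi g = \sum_(x <- D) g@_x *: phi x.
Proof.
move=> sub; rewrite /lext; apply: big_fset_incl => // x _ /mcoeff_outdom ->.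
by rewrite scale0r.
Qed.

Lemma lext_is_linear (phi : K -> W) : linear (lext phi).
Proof.
move=> c g h; pose D := (msupp g `|` msupp h)%fset.
have sD : (msupp (c *: g + h) `<=` D)%fset.
  apply: fsubset_trans (msuppD_le _ _) _.
  by apply: fsetSU; apply: msuppZ_le.
rewrite (lextw phi sD) (lextw phi (fsubsetUl _ _ : (msupp g `<=` D)%fset)).
rewrite (lextw phi (fsubsetUr _ _ : (msupp h `<=` D)%fset)).
rewrite scaler_sumr -big_split /=; apply: eq_bigr => x _.
by rewrite mcoeffD mcoeffZ scalerDl scalerA.
Qed.

HB.instance Definition _ (phi : K -> W) :=
  GRing.isLinear.Build k {malg k[K]} W _ (lext phi) (lext_is_linear phi).

Lemma lextU (phi : K -> W) (x : K) : lext phi << x >> = phi x.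
Proof.
by rewrite /lext msuppU oner_eq0 big_seq_fset1 mcoeffUU scale1r.
Qed.

Lemma malg_lin_eq (f g : {linear {malg k[K]} -> W}) :
  (forall x, f << x >> = g << x >>) -> f =1 g.
Proof.
move=> fg h; rewrite [h]monalgE !linear_sum; apply: eq_bigr => x _ /=.
have -> : << h@_x *g x >> = h@_x *: << x >> :> {malg k[K]}.
  by apply/malgP => y; rewrite mcoeffZ !mcoeffU mulr_natr.
by rewrite !linearZ /= fg.
Qed.
End LinearExtension.

Section PathAlgebra.
Variables (k : fieldType) (Q : quiver).

Fixpoint is_walk (i : vertex Q) (w : seq (arrow Q)) : bool :=
  if w is a :: w' then (src a == i) && is_walk (tgt a) w' else true.

Definition walk_end (i : vertex Q) (w : seq (arrow Q)) : vertex Q :=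
  last i (map (@tgt Q) w).

Lemma is_walk_cat i w1 w2 :
  is_walk i (w1 ++ w2) = is_walk i w1 && is_walk (walk_end i w1) w2.
Proof.
elim: w1 i => [|a w1 IH] i //=.
by rewrite IH andbA.
Qed.

Lemma walk_end_cat i w1 w2 :
  walk_end i (w1 ++ w2) = walk_end (walk_end i w1) w2.
Proof. by rewrite /walk_end map_cat last_cat. Qed.

(* A path is its starting vertex together with the list of its arrows, in the
   order in which they are traversed. *)
Record qpath := QPath {
  qpath_val : vertex Q * seq (arrow Q);
  qpath_ok : is_walk qpath_val.1 qpath_val.2 }.

HB.instance Definition _ := [isSub for qpath_val].
HB.instance Definition _ := [Choice of qpath by <:].

Definition pstart (p : qpath) : vertex Q := (val p).1.
Definition pword (p : qpath) : seq (arrow Q) := (val p).2.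
Definition pend (p : qpath) : vertex Q := walk_end (pstart p) (pword p).

Definition ptriv (i : vertex Q) : qpath := @QPath (i, [::]) isT.

Fact parrow_subproof (a : arrow Q) : is_walk (src a) [:: a].
Proof. by rewrite /= eqxx. Qed.
Definition parrow (a : arrow Q) : qpath :=
  @QPath (src a, [:: a]) (parrow_subproof a).

(* [pcomp p q] is the path "first q, then p", when it exists. *)
Definition pcomp (p q : qpath) : option qpath :=
  if pend q == pstart p then insub (pstart q, pword q ++ pword p) else None.

Definition path_algebra : Type := {malg k[qpath]}.
HB.instance Definition _ := GRing.Lmodule.copy path_algebra {malg k[qpath]}.

Implicit Types (a b c : path_algebra) (p q r : qpath).

Definition pgen p : path_algebra := << p >>.
Definition opgen (o : option qpath) : path_algebra :=
  if o is Some p then pgen p else 0.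

Definition pamul a b : path_algebra :=
  lext (fun p => lext (fun q => opgen (pcomp p q)) b) a.
Definition paone : path_algebra := \sum_i pgen (ptriv i).

Lemma qpath_eq p q : pstart p = pstart q -> pword p = pword q -> p = q.
Proof.
rewrite /pstart /pword => e1 e2; apply: val_inj.
by rewrite [val p]surjective_pairing e1 e2 -surjective_pairing.
Qed.

Variant pcomp_spec p q : option qpath -> Prop :=
| PComp r of pend q = pstart p & pstart r = pstart q
    & pword r = pword q ++ pword p & pend r = pend p : pcomp_spec p q (Some r)
| PNoComp of pend q <> pstart p : pcomp_spec p q None.

Lemma pcompP p q : pcomp_spec p q (pcomp p q).
Proof.
rewrite /pcomp; case: eqP => [e|]; last exact: PNoComp.
case: insubP => [r _ vr|]; last first.
  by rewrite /= is_walk_cat (valP q) -/(pend q) e (valP p).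
have e1 : pstart r = pstart q by rewrite /pstart vr.
have e2 : pword r = pword q ++ pword p by rewrite /pword vr.
by apply: PComp; rewrite // /pend e1 e2 walk_end_cat -/(pend q) e.
Qed.

Fact pamulDl : left_distributive pamul +%R.
Proof. by move=> a b c; rewrite /pamul linearD. Qed.

Fact pamulDr : right_distributive pamul +%R.
Proof.
move=> a b c; rewrite /pamul /lext -big_split; apply: eq_bigr => p _ /=.
by rewrite -scalerDr -/(lext _ _) -/(lext _ b) -/(lext _ c) linearD.
Qed.

Fact pamulZl (x : k) a b : pamul (x *: a) b = x *: pamul a b.
Proof. by rewrite /pamul linearZ. Qed.

Fact pamulZr (x : k) a b : pamul a (x *: b) = x *: pamul a b.
Proof.
rewrite /pamul /lext scaler_sumr; apply: eq_bigr => p _ /=.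
by rewrite -/(lext _ _) -/(lext _ b) linearZ /= !scalerA mulrC.
Qed.

Fact pamul_linl b : linear (pamul^~ b).
Proof. by move=> x a a'; rewrite pamulDl pamulZl. Qed.
Fact pamul_linr a : linear (pamul a).
Proof. by move=> x b b'; rewrite pamulDr pamulZr. Qed.

Lemma pamul0r a : pamul 0 a = 0. Proof. by rewrite /pamul linear0. Qed.
Lemma pamulr0 a : pamul a 0 = 0.
Proof. by have := pamulZr 0 a 0; rewrite !scale0r. Qed.

Lemma pamulU p q : pamul (pgen p) (pgen q) = opgen (pcomp p q).
Proof. by rewrite /pamul !lextU. Qed.

Lemma pa_lin_eq (W : lmodType k) (f g : path_algebra -> W) :
  linear f -> linear g -> (forall p, f (pgen p) = g (pgen p)) -> f =1 g.
Proof.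
move=> lf lg fg.
pose fL := GRing.isLinear.Build k {malg k[qpath]} W _ f lf.
pose gL := GRing.isLinear.Build k {malg k[qpath]} W _ g lg.
pose f' : {linear {malg k[qpath]} -> W} := HB.pack f fL.
pose g' : {linear {malg k[qpath]} -> W} := HB.pack g gL.
exact: (@malg_lin_eq _ _ _ f' g').
Qed.

Fact pamulA : associative pamul.
Proof.
move=> a b c.
apply: (pa_lin_eq (f := fun a => pamul a (pamul b c))
                  (g := fun a => pamul (pamul a b) c)) => [||p].
- exact: pamul_linl.
- by move=> x u v; rewrite !(pamulDl, pamulZl).
apply: (pa_lin_eq (f := fun b => pamul (pgen p) (pamul b c))
                  (g := fun b => pamul (pamul (pgen p) b) c)) => [||q].
- by move=> x u v; rewrite !(pamulDl, pamulZl, pamulDr, pamulZr).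
- by move=> x u v; rewrite !(pamulDl, pamulZl, pamulDr, pamulZr).
apply: (pa_lin_eq (f := fun c => pamul (pgen p) (pamul (pgen q) c))
                  (g := fun c => pamul (pamul (pgen p) (pgen q)) c)) => [||r].
- by move=> x u v; rewrite !(pamulDr, pamulZr).
- exact: pamul_linr.
rewrite !pamulU.
case: (pcompP q r) => [qr j1 s1 w1 t1|n1];
  case: (pcompP p q) => [pq j2 s2 w2 t2|n2];
  rewrite /= ?pamulU ?pamul0r ?pamulr0 //.
- case: (pcompP p qr) => [u _ s3 w3 _|[]]; last by rewrite t1.
  case: (pcompP pq r) => [v _ s4 w4 _|[]]; last by rewrite s2.
  congr (pgen _); apply: qpath_eq; first by rewrite s3 s4.
  by rewrite w3 w4 w1 w2 catA.
- by case: (pcompP p qr) => // u; rewrite t1.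
- by case: (pcompP pq r) => // u; rewrite s2.
Qed.

Fact pamul1r : left_id paone pamul.
Proof.
move=> a; apply: (pa_lin_eq (f := fun a => pamul paone a) (g := id)) => [||p].
- exact: pamul_linr.
- by [].
have -> : pamul paone (pgen p) = \sum_i pamul (pgen (ptriv i)) (pgen p).
  rewrite /paone; elim/big_rec2: _ => [|i y x _ <-]; first exact: pamul0r.
  by rewrite pamulDl.
rewrite (bigD1 (pend p)) //= big1 => [|i ne]; rewrite pamulU.
  case: pcompP => // r _ s w _; rewrite addr0; congr (pgen _).
  by apply: qpath_eq; rewrite // w cats0.
by case: pcompP => // r e _ _ _; rewrite e eqxx in ne.
Qed.

Fact pamulr1 : right_id paone pamul.
Proof.
move=> a; apply: (pa_lin_eq (f := fun a => pamul a paone) (g := id)) => [||p].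
- exact: pamul_linl.
- by [].
have -> : pamul (pgen p) paone = \sum_i pamul (pgen p) (pgen (ptriv i)).
  rewrite /paone; elim/big_rec2: _ => [|i y x _ <-]; first exact: pamulr0.
  by rewrite pamulDr.
rewrite (bigD1 (pstart p)) //= big1 => [|i ne]; rewrite pamulU.
  case: pcompP => // r _ s w _; rewrite addr0; congr (pgen _).
  exact: qpath_eq.
by case: pcompP => // r e _ _ _; rewrite -e eqxx in ne.
Qed.

(* Only a [pzRingType]: for the quiver without vertices the path algebra is the
   zero ring. *)
HB.instance Definition _ := GRing.Zmodule_isPzRing.Build path_algebra
  pamulA pamul1r pamulr1 pamulDl pamulDr.

Lemma pa_scalerAl (x : k) a b : x *: (a * b) = (x *: a) * b.
Proof. by rewrite [RHS]pamulZl. Qed.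
Lemma pa_scalerAr (x : k) a b : x *: (a * b) = a * (x *: b).
Proof. by rewrite [RHS]pamulZr. Qed.

Definition e_ (i : vertex Q) : path_algebra := pgen (ptriv i).
Definition x_ (a : arrow Q) : path_algebra := pgen (parrow a).

End PathAlgebra.

Arguments e_ {k Q} i.
Arguments x_ {k Q} a.

(* Restriction of scalars from kQ to k. *)
Definition kscale (k : fieldType) (Q : quiver) (M : lmodType (path_algebra k Q))
  (c : k) (x : M) : M := (c *: (1 : path_algebra k Q)) *: x.

Section PathAction.
Variables (k : fieldType) (Q : quiver) (W : lmodType k).
Variables (e : vertex Q -> {linear W -> W}) (x : arrow Q -> {linear W -> W}).

Definition path_act (p : qpath Q) (w : W) : W :=
  foldl (fun v a => x a v) (e (pstart p) w) (pword p).

Definition pa_act (a : path_algebra k Q) (w : W) : W :=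
  lext (path_act^~ w) a.

Hypothesis e_orth : forall i j w, e i (e j w) = if i == j then e i w else 0.
Hypothesis e_sum : forall w, \sum_i e i w = w.
Hypothesis xe : forall a w, x a (e (src a) w) = x a w.
Hypothesis ex : forall a w, e (tgt a) (x a w) = x a w.

Lemma foldl_is_linear s : linear (foldl (fun v a => x a v) ^~ s).
Proof.
by elim: s => [|a s IH] c u v //=; rewrite linearP IH.
Qed.

Lemma path_act_is_linear p : linear (path_act p).
Proof. by move=> c u v; rewrite /path_act linearP foldl_is_linear. Qed.

Lemma pa_act_gen p w : pa_act (pgen k p) w = path_act p w.
Proof. by rewrite /pa_act lextU. Qed.

Lemma pa_act_linl w : linear (pa_act^~ w).
Proof. by move=> c a b; rewrite /pa_act linearP. Qed.

Lemma pa_act_linr a : linear (pa_act a).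
Proof.
move=> c u v; rewrite /pa_act /lext scaler_sumr -big_split.
apply: eq_bigr => p _ /=.
by rewrite path_act_is_linear scalerDr !scalerA mulrC.
Qed.

Lemma path_act_end p w : e (pend p) (path_act p w) = path_act p w.
Proof.
rewrite /path_act /pend /walk_end.
elim/last_ind: (pword p) => [|s a _] /=; first by rewrite e_orth eqxx.
by rewrite map_rcons last_rcons -cats1 foldl_cat /= ex.
Qed.

Lemma path_act0 p q w : pend q != pstart p -> path_act p (path_act q w) = 0.
Proof.
move=> ne; rewrite -(path_act_end q) /path_act e_orth eq_sym (negPf ne).
by elim: (pword p) => //= a s IH; rewrite linear0.
Qed.

Fact pa_actA a b w : pa_act a (pa_act b w) = pa_act (a * b) w.
Proof.
apply: (pa_lin_eq (f := fun a => pa_act a (pa_act b w))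
                  (g := fun a => pa_act (a * b) w)) => [||p].
- exact: pa_act_linl.
- by move=> c u v; rewrite mulrDl -pa_scalerAl pa_act_linl.
apply: (pa_lin_eq (f := fun b => pa_act (pgen k p) (pa_act b w))
                  (g := fun b => pa_act (pgen k p * b) w)) => [||q].
- by move=> c u v; rewrite pa_act_linl pa_act_linr.
- by move=> c u v; rewrite mulrDr -pa_scalerAr pa_act_linl.
rewrite [pgen k p * pgen k q]pamulU !pa_act_gen.
case: pcompP => [r j s ww _|/eqP ne] /=; last first.
  by rewrite path_act0 // /pa_act [RHS]linear0.
rewrite pa_act_gen {1}/path_act -j path_act_end.
by rewrite /path_act s ww foldl_cat.
Qed.

Fact pa_act1 w : pa_act 1 w = w.
Proof.
rewrite -[RHS]e_sum [1]/(paone k Q) /paone.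
rewrite /pa_act linear_sum; apply: eq_bigr => i _ /=.
by rewrite -/(pa_act _ _) pa_act_gen.
Qed.

Fact pa_actDr a : {morph pa_act a : u v / u + v}.
Proof.
by move=> u v; rewrite -{1}[u]scale1r pa_act_linr scale1r.
Qed.

Fact pa_actDl w : {morph pa_act^~ w : a b / a + b}.
Proof. by move=> a b; rewrite -{1}[a]scale1r pa_act_linl scale1r. Qed.

End PathAction.

Section DependentProduct.
Variables (k : fieldType) (I : finType) (V : I -> vectType k).

Definition dprod : Type := {dffun forall i : I, V i}.
HB.instance Definition _ := Choice.on dprod.

Implicit Types f g h : dprod.

Definition dp_of (F : forall i, V i) : dprod := finfun F.
Definition dp_at f (i : I) : V i := f i.

Lemma dp_ofE F i : dp_at (dp_of F) i = F i. Proof. exact: ffunE. Qed.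
Lemma dpP f g : (forall i, dp_at f i = dp_at g i) -> f = g.
Proof. by move=> fg; apply/ffunP. Qed.

Definition dp_inj (i : I) (v : V i) : dprod :=
  dp_of (fun j => if i =P j is ReflectT e then ecast j (V j) e v else 0).

Lemma dp_inj_id i v : dp_at (dp_inj v) i = v.
Proof. by rewrite dp_ofE; case: eqP => // e; rewrite eq_axiomK. Qed.
Lemma dp_inj_ne i j (v : V i) : i != j -> dp_at (dp_inj v) j = 0.
Proof. by rewrite dp_ofE; case: eqP. Qed.

Definition dp_add f g := dp_of (fun i => dp_at f i + dp_at g i).
Definition dp_opp f := dp_of (fun i => - dp_at f i).
Definition dp_zero := dp_of (fun i => 0).
Definition dp_scale (c : k) f := dp_of (fun i => c *: dp_at f i).

Fact dp_addA : associative dp_add.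
Proof. by move=> f g h; apply: dpP => i; rewrite !dp_ofE addrA. Qed.
Fact dp_addC : commutative dp_add.
Proof. by move=> f g; apply: dpP => i; rewrite !dp_ofE addrC. Qed.
Fact dp_add0 : left_id dp_zero dp_add.
Proof. by move=> f; apply: dpP => i; rewrite !dp_ofE add0r. Qed.
Fact dp_addN : left_inverse dp_zero dp_opp dp_add.
Proof. by move=> f; apply: dpP => i; rewrite !dp_ofE addNr. Qed.
HB.instance Definition _ :=
  GRing.isZmodule.Build dprod dp_addA dp_addC dp_add0 dp_addN.

Fact dp_scaleA a b f : dp_scale a (dp_scale b f) = dp_scale (a * b) f.
Proof. by apply: dpP => i; rewrite !dp_ofE scalerA. Qed.
Fact dp_scale1 : left_id 1 dp_scale.
Proof. by move=> f; apply: dpP => i; rewrite !dp_ofE scale1r. Qed.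
Fact dp_scaleDr : right_distributive dp_scale +%R.
Proof. by move=> c f g; apply: dpP => i; rewrite !dp_ofE scalerDr. Qed.
Fact dp_scaleDl f : {morph dp_scale^~ f : a b / a + b}.
Proof. by move=> a b; apply: dpP => i; rewrite !dp_ofE scalerDl. Qed.
HB.instance Definition _ := GRing.Zmodule_isLmodule.Build k dprod
  dp_scaleA dp_scale1 dp_scaleDr dp_scaleDl.

Definition dp_index : Type := {i : I & 'I_(dim (V i))}.
HB.instance Definition _ := Finite.on dp_index.

Fact dp_vect_iso : Vector.axiom #|{: dp_index}| dprod.
Proof.
pose c f (t : dp_index) : k := v2r (dp_at f (tag t)) 0 (tagged t).
exists (fun f => \row_j c f (enum_val j)).
  move=> a f g; apply/rowP => j; rewrite !mxE /c dp_ofE.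
  by rewrite [dp_at (a *: f) _]dp_ofE linearP !mxE.
exists (fun r : 'rV_ _ => dp_of (fun i => r2v
  (\row_l r 0 (enum_rank (Tagged (fun i => 'I_(dim (V i))) l : dp_index))))).
  move=> f; apply: dpP => i; rewrite dp_ofE -[RHS]v2rK; congr r2v.
  by apply/rowP => l; rewrite !mxE enum_rankK /c.
move=> r; apply/rowP => j; rewrite mxE /c dp_ofE r2vK mxE.
have -> : Tagged (fun i => 'I_(dim (V i))) (tagged (enum_val j)) = enum_val j.
  by case: (enum_val j).
by rewrite enum_valK.
Qed.
HB.instance Definition _ := Lmodule_hasFinDim.Build k dprod dp_vect_iso.

Lemma dp_atP i a f g : dp_at (a *: f + g) i = a *: dp_at f i + dp_at g i.
Proof. by rewrite !dp_ofE. Qed.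
Lemma dp_atD i f g : dp_at (f + g) i = dp_at f i + dp_at g i.
Proof. exact: dp_ofE. Qed.
Lemma dp_at0 i : dp_at 0 i = 0.
Proof. exact: dp_ofE. Qed.

Lemma dp_inj_is_linear i : linear (@dp_inj i).
Proof.
move=> a u v; apply: dpP => j; rewrite dp_atP.
have [e|ne] := eqVneq i j; first by case: _ / e; rewrite !dp_inj_id.
by rewrite !dp_inj_ne // scaler0 addr0.
Qed.
HB.instance Definition _ i :=
  GRing.isLinear.Build k (V i) dprod _ (@dp_inj i) (@dp_inj_is_linear i).
End DependentProduct.

Definition mxfamily (R : Type) (Q : quiver) (d : vertex Q -> nat) : Type :=
  forall a : arrow Q, 'M[R]_(d (tgt a), d (src a)).

Section Representations.
Variables (k : fieldType) (Q : quiver) (d : vertex Q -> nat).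

Definition rep : Type :=
  dprod (fun a : arrow Q => 'M[k]_(d (tgt a), d (src a))).
HB.instance Definition _ := Vector.copy rep
  (dprod (fun a : arrow Q => 'M[k]_(d (tgt a), d (src a)))).

Definition rep_fam (M : rep) : mxfamily k d := fun a => dp_at M a.

Definition rep_space : Type := dprod (fun i : vertex Q => 'cV[k]_(d i)).
HB.instance Definition _ := Vector.copy rep_space
  (dprod (fun i : vertex Q => 'cV[k]_(d i))).

Definition vec_in (i : vertex Q) (v : 'cV[k]_(d i)) : rep_space := dp_inj v.

Variable M : rep.

Definition rep_e (i : vertex Q) (u : rep_space) : rep_space :=
  vec_in (dp_at u i).
Definition rep_x (a : arrow Q) (u : rep_space) : rep_space :=
  vec_in (rep_fam M a *m dp_at u (src a)).

Fact rep_e_is_linear i : linear (rep_e i).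
Proof. by move=> c u v; rewrite /rep_e /vec_in dp_atP linearP. Qed.
HB.instance Definition _ i :=
  GRing.isLinear.Build k rep_space rep_space _ (rep_e i) (rep_e_is_linear i).

Fact rep_x_is_linear a : linear (rep_x a).
Proof. by move=> c u v; rewrite /rep_x /vec_in dp_atP !linearP. Qed.
HB.instance Definition _ a :=
  GRing.isLinear.Build k rep_space rep_space _ (rep_x a) (rep_x_is_linear a).

Fact rep_e_orth i j u :
  rep_e i (rep_e j u) = if i == j then rep_e i u else 0.
Proof.
rewrite /rep_e /vec_in; have [->|ne] := eqVneq i j; first by rewrite dp_inj_id.
by rewrite dp_inj_ne 1?eq_sym // linear0.
Qed.

Fact rep_e_sum u : \sum_i rep_e i u = u.
Proof.
apply: dpP => j.
have -> : dp_at (\sum_i rep_e i u) j = \sum_i dp_at (rep_e i u) j.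
  by elim/big_rec2: _ => [|i y x _ <-]; rewrite ?dp_at0 ?dp_atD.
rewrite (bigD1 j) //= dp_inj_id big1 ?addr0 // => i ne.
by rewrite dp_inj_ne.
Qed.

Fact rep_xe a u : rep_x a (rep_e (src a) u) = rep_x a u.
Proof. by rewrite /rep_x dp_inj_id. Qed.

Fact rep_ex a u : rep_e (tgt a) (rep_x a u) = rep_x a u.
Proof. by rewrite /rep_e dp_inj_id. Qed.

End Representations.

(* The kQ-module attached to the point M of Rep_d(Q), on the direct sum of the
   spaces k^(d i). *)
Definition rep_mod (k : fieldType) (Q : quiver) (d : vertex Q -> nat)
  (M : rep k d) : Type := rep_space k d.

Section RepModule.
Variables (k : fieldType) (Q : quiver) (d : vertex Q -> nat) (M : rep k d).

HB.instance Definition _ := GRing.Zmodule.copy (rep_mod M) (rep_space k d).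

HB.instance Definition _ := GRing.Zmodule_isLmodule.Build (path_algebra k Q)
  (rep_mod M)
  (pa_actA (@rep_e_orth k Q d) (rep_ex M))
  (pa_act1 (rep_x M) (@rep_e_sum k Q d))
  (pa_actDr (@rep_e k Q d) (rep_x M)) (pa_actDl (@rep_e k Q d) (rep_x M)).
End RepModule.

Section Kernel.
Variables (A : pzRingType) (U V : lmodType A) (f : {linear U -> V}).

Definition in_ker : pred U := fun u => f u == 0.

Fact in_ker_submod_closed : submod_closed in_ker.
Proof.
split=> [|c u v]; rewrite unfold_in /in_ker ?linear0 //.
rewrite !unfold_in /in_ker.
by move=> /eqP fu /eqP fv; rewrite linearP fu fv scaler0 addr0.
Qed.
HB.instance Definition _ := GRing.isSubmodClosed.Build A U in_ker
  in_ker_submod_closed.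

Definition ker_mod : Type := {u : U | in_ker u}.
HB.instance Definition _ := SubType.on ker_mod.
HB.instance Definition _ := [Choice of ker_mod by <:].
HB.instance Definition _ := [SubChoice_isSubLmodule of ker_mod by <:].
End Kernel.

Section FreeCover.
Variables (A : pzRingType) (N : lmodType A).

(* The free left A-module on the underlying set of N.  [malg] only comes with a
   module structure over nonzero rings. *)
Definition free_cover : Type := {malg A[N]}.
HB.instance Definition _ := GRing.Zmodule.copy free_cover {malg A[N]}.

Definition fc_coef (g : free_cover) (n : N) : A := g@_n.

Definition fc_scale (a : A) (g : free_cover) : free_cover :=
  [malg n in msupp g => a * g@_n].

Lemma fc_scaleE a g n : fc_coef (fc_scale a g) n = a * fc_coef g n.
Proof.
rewrite /fc_coef /fc_scale mcoeffE; case: ifPn => // h.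
by rewrite mcoeff_outdom // mulr0.
Qed.

Fact fc_scaleA a b g : fc_scale a (fc_scale b g) = fc_scale (a * b) g.
Proof.
by apply/malgP => n; rewrite -!/(fc_coef _ n) !fc_scaleE mulrA.
Qed.
Fact fc_scale1 : left_id 1 fc_scale.
Proof. by move=> g; apply/malgP => n; rewrite -!/(fc_coef _ n) fc_scaleE mul1r. Qed.
Fact fc_scaleDr : right_distributive fc_scale +%R.
Proof.
move=> a g h; apply/malgP => n.
by rewrite mcoeffD -!/(fc_coef _ n) !fc_scaleE -mulrDr -[in RHS]mcoeffD.
Qed.
Fact fc_scaleDl g : {morph fc_scale^~ g : a b / a + b}.
Proof.
by move=> a b; apply/malgP => n; rewrite mcoeffD -!/(fc_coef _ n) !fc_scaleE mulrDl.
Qed.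
HB.instance Definition _ := GRing.Zmodule_isLmodule.Build A free_cover
  fc_scaleA fc_scale1 fc_scaleDr fc_scaleDl.

Definition fc_proj (g : free_cover) : N := \sum_(n <- msupp g) fc_coef g n *: n.

Fact fc_proj_is_linear : linear fc_proj.
Proof.
have ext (g : free_cover) (D : {fset N}) : (msupp g `<=` D)%fset ->
    fc_proj g = \sum_(n <- D) fc_coef g n *: n.
  move=> sub; rewrite /fc_proj; apply: big_fset_incl => // x _ /mcoeff_outdom h.
  by rewrite /fc_coef h scale0r.
move=> c g h; pose D := (msupp g `|` msupp h)%fset.
rewrite (ext g D) ?fsubsetUl // (ext h D) ?fsubsetUr //.
rewrite (ext _ D); last first.
  apply: fsubset_trans (msuppD_le _ _) _; apply: fsetSU.
  apply/fsubsetP => n; rewrite -!mcoeff_neq0 -/(fc_coef _ n) fc_scaleE.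
  by apply: contraNN => /eqP; rewrite /fc_coef => ->; rewrite mulr0.
rewrite scaler_sumr -big_split /=; apply: eq_bigr => n _.
by rewrite /fc_coef mcoeffD -/(fc_coef _ n) fc_scaleE scalerDl scalerA.
Qed.
HB.instance Definition _ :=
  GRing.isLinear.Build A free_cover N _ fc_proj fc_proj_is_linear.
End FreeCover.

(* With P := A^(N) the free module on the set N and 0 -> O -> P -> N -> 0 the
   canonical presentation, Ext^1_A(N, M) is the cokernel of the restriction map
   Hom_A(P, M) -> Hom_A(O, M).  It has k-dimension [n] when it has a basis made
   of the classes of [n] elements [b] of Hom_A(O, M). *)
Definition ext1_dim (k : fieldType) (Q : quiver)
    (N M : lmodType (path_algebra k Q)) (n : nat) : Prop :=
  exists b : 'I_n -> {linear ker_mod (@fc_proj _ N) -> M},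
  forall phi : {linear ker_mod (@fc_proj _ N) -> M},
  exists! c : 'rV[k]_n, exists psi : {linear free_cover N -> M},
  forall x, phi x = \sum_(l < n) kscale (c 0 l) (b l x) + psi (val x).

Definition euler_form (Q : quiver) (d e : vertex Q -> nat) : int :=
  \sum_(i : vertex Q) (d i * e i)%:Z
  - \sum_(a : arrow Q) (d (src a) * e (tgt a))%:Z.

(* [rho i] is a k-basis of e_i T, hence [t] is the dimension vector of T. *)
Definition adapted_basis (k : fieldType) (Q : quiver)
    (T : lmodType (path_algebra k Q)) (t : vertex Q -> nat)
    (rho : forall i, 'I_(t i) -> T) : Prop :=
  forall i, (forall l, e_ i *: rho i l = rho i l) /\
    (forall x : T, e_ i *: x = x ->
      exists! c : 'rV[k]_(t i), x = \sum_l kscale (c 0 l) (rho i l)).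

Definition structure_constants (k : fieldType) (Q : quiver)
    (T : lmodType (path_algebra k Q)) (t : vertex Q -> nat)
    (rho : forall i, 'I_(t i) -> T) (lam : mxfamily k t) : Prop :=
  forall (a : arrow Q) (l : 'I_(t (src a))),
    x_ a *: rho (src a) l = \sum_m kscale (lam a m l) (rho (tgt a) m).

Section OnePointExtension.
Variables (Q : quiver) (t : vertex Q -> nat).

(* The vertex [None] is the added vertex oo; the arrow [inr (existT i l)] is
   rho_{l,(i)} : oo -> i. *)
Definition hat_arrow : finType := (arrow Q + {i : vertex Q & 'I_(t i)})%type.
Definition hat_src (b : hat_arrow) : option (vertex Q) :=
  if b is inl a then Some (src a) else None.
Definition hat_tgt (b : hat_arrow) : option (vertex Q) :=
  match b with inl a => Some (tgt a) | inr il => Some (tag il) end.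
Definition hat_quiver : quiver :=
  @Quiver (option (vertex Q)) hat_arrow hat_src hat_tgt.

Definition old_arrow (a : arrow Q) : arrow hat_quiver := inl a.
Definition new_arrow (i : vertex Q) (l : 'I_(t i)) : arrow hat_quiver :=
  inr (Tagged (fun i => 'I_(t i)) l).

Variables (s : nat) (d : vertex Q -> nat).

Definition hat_dim (o : vertex hat_quiver) : nat := if o is Some i then d i else s.

Definition old_mat (R : Type) (N : mxfamily R hat_dim) (a : arrow Q) :
  'M[R]_(d (tgt a), d (src a)) := N (old_arrow a).
Definition new_mat (R : Type) (N : mxfamily R hat_dim) (i : vertex Q)
  (l : 'I_(t i)) : 'M[R]_(d i, s) := N (new_arrow l).

(* alpha rho_{l,(i)} - sum_m lambda^(alpha)_{m,l} rho_{m,(j)}, alpha : i -> j,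
   over an arbitrary commutative ring of coordinates *)
Definition rel_mx (R : comNzRingType) (lam : mxfamily R t)
    (N : mxfamily R hat_dim) (a : arrow Q) (l : 'I_(t (src a))) :
    'M[R]_(d (tgt a), s) :=
  old_mat N a *m new_mat N l - \sum_m lam a m l *: new_mat N m.

Variable k : fieldType.

Definition in_Rep (lam : mxfamily k t) (N : rep k hat_dim) : Prop :=
  forall (a : arrow Q) (l : 'I_(t (src a))), rel_mx lam (rep_fam N) l = 0.

(* N + eps v *)
Definition first_order (N v : rep k hat_dim) : mxfamily {poly k} hat_dim :=
  fun b => map_mx polyC (rep_fam N b) + 'X *: map_mx polyC (rep_fam v b).

(* [v] is a tangent vector of the scheme Rep_(s,d)(A[T]) at the point [N]:
   N + eps v is a k[eps]/(eps^2)-valued point. *)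
Definition tangent_vector (lam : mxfamily k t) (N v : rep k hat_dim) : Prop :=
  forall (a : arrow Q) (l : 'I_(t (src a))) r c,
    'X^2 %| rel_mx (fun b => map_mx polyC (lam b)) (first_order N v) l r c.

Definition tangent_space (lam : mxfamily k t) (N : rep k hat_dim)
    (U : {vspace rep k hat_dim}) : Prop :=
  forall v, v \in U <-> tangent_vector lam N v.

Definition rep_restr (N : rep k hat_dim) : rep k d :=
  dp_of (fun a : arrow Q => old_mat (rep_fam N) a).
End OnePointExtension.

(* T (x)_k k^s is realized as the direct sum of s copies of T. *)
Definition tens (k : fieldType) (Q : quiver) (T : lmodType (path_algebra k Q))
    (s : nat) (x : T) (v : 'cV[k]_s) : {ffun 'I_s -> T} :=
  [ffun j => kscale (v j 0) x].

(* f : T (x)_k V -> M is the A-linear map encoded by the arrows rho_{l,(i)} of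
   the representation [N]. *)
Definition structure_map (k : fieldType) (Q : quiver)
    (T : lmodType (path_algebra k Q)) (t : vertex Q -> nat)
    (rho : forall i, 'I_(t i) -> T) (s : nat) (d : vertex Q -> nat)
    (N : rep k (@hat_dim Q t s d))
    (f : {linear {ffun 'I_s -> T} -> rep_mod (rep_restr N)}) : Prop :=
  forall (i : vertex Q) (l : 'I_(t i)) (v : 'cV[k]_s),
    f (tens (rho i l) v) = vec_in (new_mat (rep_fam N) l *m v).

(* Main.v *)
Require Import Defs.
From HB Require Import structures.
From mathcomp Require Import all_boot all_order all_algebra.
From mathcomp Require Import finmap.
From mathcomp.multinomials Require Import monalg.

Set Implicit Arguments.
Unset Strict Implicit.
Unset Printing Implicit Defensive.

Import GRing.Theory.
Local Open Scope ring_scope.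

(** The relations of A[T], linearized at the point Mt = (M, V, f), define a
    linear map Phi (below [drel_map]) from Rep_(s,d) of the extended quiver to
    the space Z of families of matrices indexed by the relations, and the
    tangent space is the kernel of Phi ([tangent_vectorE]).  The source of Phi
    has dimension dim Rep_d(Q) + s * sum_i t_i d_i and Z has dimension
    s * sum_(a : i -> j) t_i d_j; by rank-nullity the theorem says that the
    cokernel of Phi has the dimension of Ext^1_A(K, M), K := ker f.

    For modules over a path algebra, Ext^1_A(N, M) is the cokernel of the map
    sending a family of linear maps h_i : N_i -> M_i to the family
    h_j x_a - x_a h_i of linear maps N_i -> M_j, a : i -> j: cochains modulo
    coboundaries.  Here Ext^1 is given by the free cover P of N and its kernel
    O, and the bridge is made of twisted maps: k-linear maps g : P -> M that
    commute with the vertex idempotents and fail to commute with an arrow a by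
    a cochain c evaluated on N.  The restriction of g to O is A-linear
    ([twisted_linear]); every cochain twists some g ([twisted_mapP]); every
    A-linear map on O arises in this way ([syzygy_hom_twisted]); and it extends
    to P exactly when c is a coboundary ([twisted_extends]).

    Finally, an element of Z is a family of linear maps from (T (x) V)_i to
    M_j, one for each arrow a : i -> j of Q, and restricting them to K gives a
    cochain.  All cochains are restrictions.  The contribution to Phi of the new
    arrows restricts to coboundaries, and all coboundaries are obtained; the
    contribution of the old arrows consists of the maps that factor through
    f_i, that is, of those that vanish on K_i.  Hence an element of Z is in the
    image of Phi if and only if its cochain is a coboundary
    ([drel_coboundary], [coboundary_is_drel]). *)

(** * Modules over the path algebra as vector spaces *)
Section RestrictionOfScalars.
Variables (k : fieldType) (Q : quiver).
Notation A := (path_algebra k Q).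
Implicit Types (M N : lmodType A) (c : k) (a b : A).

Lemma kscaleZ M c a (x : M) : (c *: a) *: x = kscale c (a *: x).
Proof. by rewrite /kscale [RHS]scalerA -pa_scalerAl mul1r. Qed.

Lemma scaler_kscale M c a (x : M) : a *: kscale c x = kscale c (a *: x).
Proof. by rewrite -kscaleZ /kscale [LHS]scalerA -pa_scalerAr mulr1. Qed.

Lemma linear_kscale M N (g : {linear M -> N}) c x :
  g (kscale c x) = kscale c (g x).
Proof. by rewrite /kscale linearZ. Qed.

Fact kscaleA M c1 c2 (x : M) : kscale c1 (kscale c2 x) = kscale (c1 * c2) x.
Proof. by rewrite /kscale [LHS]scalerA -pa_scalerAl mul1r [c1 *: _]scalerA. Qed.

Fact kscale1 M : left_id 1 (@kscale k Q M).
Proof. by move=> x; rewrite /kscale !scale1r. Qed.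

Fact kscaleDr M : right_distributive (@kscale k Q M) +%R.
Proof. by move=> c x y; rewrite /kscale scalerDr. Qed.

Fact kscaleDl M x : {morph (@kscale k Q M)^~ x : c1 c2 / c1 + c2}.
Proof. by move=> c1 c2; rewrite /kscale !scalerDl. Qed.

(** An alias, since M itself is already declared as a module over A: it lets
    A-modules serve where a k-vector space is expected. *)
Definition restr_scalars M : Type := M.
HB.instance Definition _ M := GRing.Zmodule.copy (restr_scalars M) M.
HB.instance Definition _ M := GRing.Zmodule_isLmodule.Build k (restr_scalars M)
  (@kscaleA M) (@kscale1 M) (@kscaleDr M) (@kscaleDl M).

Lemma kscale_sum M c (I : Type) (r : seq I) (P : pred I) (F : I -> M) :
  kscale c (\sum_(i <- r | P i) F i) = \sum_(i <- r | P i) kscale c (F i).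
Proof. by rewrite /kscale scaler_sumr. Qed.

Lemma kscale0 M (x : M) : kscale 0 x = 0.
Proof. by rewrite /kscale !scale0r. Qed.
Lemma kscaler0 M c : kscale c (0 : M) = 0.
Proof. by rewrite /kscale scaler0. Qed.
Lemma kscaleN M c (x : M) : kscale c (- x) = - kscale c x.
Proof. by rewrite /kscale scalerN. Qed.

Lemma kscale_suml M (I : Type) (r : seq I) (P : pred I) (F : I -> k) (x : M) :
  kscale (\sum_(i <- r | P i) F i) x = \sum_(i <- r | P i) kscale (F i) x.
Proof. exact: (big_morph _ (kscaleDl x) (kscale0 x)). Qed.

Lemma e_mul i j : e_ i * e_ j = (if i == j then e_ i else 0) :> A.
Proof.
rewrite [LHS]pamulU; case: pcompP => [r ji s w _|].
  rewrite /pend /= in ji; rewrite -[i]ji /pstart /walk_end /= eqxx.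
  by congr pgen; apply: qpath_eq; rewrite ?s ?w.
by rewrite /pend /pstart /walk_end /=; case: eqP => // ->.
Qed.

Lemma sum_e : \sum_i e_ i = 1 :> A.
Proof. by []. Qed.

Lemma sum_e_scale M (u : M) : \sum_i e_ i *: u = u.
Proof. by rewrite -scaler_suml sum_e scale1r. Qed.

(** The idempotents sum to 1, so elements and maps can be handled one vertex at
    a time. *)
Lemma eq_by_e M (u v : M) :
  (forall i, e_ i *: u = e_ i *: v) -> u = v.
Proof.
by move=> e; rewrite -[u]sum_e_scale -[v]sum_e_scale; apply: eq_bigr.
Qed.

Lemma e_sum_e M (F : vertex Q -> M) i :
  e_ i *: (\sum_j e_ j *: F j) = e_ i *: F i.
Proof.
rewrite scaler_sumr (bigD1 i) //= scalerA e_mul eqxx big1 ?addr0 // => j ne.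
by rewrite scalerA e_mul eq_sym (negPf ne) scale0r.
Qed.

Lemma x_src (a : arrow Q) : x_ a * e_ (src a) = x_ a :> A.
Proof.
rewrite [LHS]pamulU; case: pcompP => [r _ s w _|//].
by congr pgen; apply: qpath_eq; rewrite ?s ?w.
Qed.

Lemma tgt_x (a : arrow Q) : e_ (tgt a) * x_ a = x_ a :> A.
Proof.
rewrite [LHS]pamulU; case: pcompP => [r _ s w _|//].
by congr pgen; apply: qpath_eq; rewrite ?s ?w.
Qed.

Definition klinear M N (g : M -> N) :=
  forall c x y, g (kscale c x + y) = kscale c (g x) + g y.

Lemma scaler_klinear M a : klinear (fun x : M => a *: x).
Proof. by move=> c x y; rewrite scalerDr scaler_kscale. Qed.

(** A path is built from its trivial path by composing arrows on the left, the
    side on which A acts on modules. *)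
Lemma pgen_ind (P : A -> Prop) :
  (forall i, P (e_ i)) ->
  (forall (a : arrow Q) p, P (pgen k p) -> P (x_ a * pgen k p)) ->
  forall p, P (pgen k p).
Proof.
move=> Pe Px p; move: {2}(size (pword p)) (erefl (size (pword p))) => n.
elim: n p => [|n IH] p sz.
  suff -> : pgen k p = e_ (pstart p) by apply: Pe.
  by congr pgen; apply: qpath_eq; rewrite ?(size0nil sz).
have : is_walk (pstart p) (pword p) := valP p.
case/lastP E : (pword p) sz => [//|w a]; rewrite size_rcons => -[sz].
rewrite -cats1 is_walk_cat => /andP[wok /= /andP[/eqP st _]].
pose q := @QPath Q (pstart p, w) wok.
suff -> : pgen k p = x_ a * pgen k q by apply: Px; apply: IH.
rewrite [RHS]pamulU; case: pcompP => [r _ s ww _|[]]; last first.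
  by rewrite /pend /pword /= -st.
by congr pgen; apply: qpath_eq; rewrite ?s ?ww // E cats1.
Qed.
End RestrictionOfScalars.

Section KLinearMaps.
Variables (k : fieldType) (Q : quiver).
Notation A := (path_algebra k Q).
Variables (M N : lmodType A) (g : M -> N).
Hypothesis gk : klinear g.

Lemma klinearD x y : g (x + y) = g x + g y.
Proof. by rewrite -[x in LHS]kscale1 gk kscale1. Qed.

Lemma klinear0 : g 0 = 0.
Proof. by apply: (addrI (g 0)); rewrite -klinearD !addr0. Qed.

Lemma klinearZ c x : g (kscale c x) = kscale c (g x).
Proof. by rewrite -[kscale c x in LHS]addr0 gk klinear0 addr0. Qed.

Lemma klinearB x y : g (x - y) = g x - g y.
Proof. by apply: (addIr (g y)); rewrite -klinearD !subrK. Qed.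

Lemma klinear_sum (I : Type) (r : seq I) (P : pred I) (F : I -> M) :
  g (\sum_(i <- r | P i) F i) = \sum_(i <- r | P i) g (F i).
Proof. exact: (big_morph _ klinearD klinear0). Qed.

(** A is generated as a k-algebra by idempotents and arrows, so commuting with
    these is enough. *)
Lemma klinear_linear :
  (forall i x, g (e_ i *: x) = e_ i *: g x) ->
  (forall (a : arrow Q) x, g (x_ a *: x) = x_ a *: g x) -> linear g.
Proof.
move=> ge gx a x y; rewrite klinearD; congr (_ + _).
apply: (pa_lin_eq (W := restr_scalars N)
         (f := fun a => g (a *: x)) (g := fun a => a *: g x)).
- by move=> c u v; rewrite scalerDl kscaleZ gk.
- by move=> c u v; rewrite scalerDl kscaleZ.
apply: (pgen_ind (P := fun b => g (b *: x) = b *: g x)) => [i|b p IH].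
  exact: ge.
by rewrite -!scalerA gx IH.
Qed.
End KLinearMaps.

Section VertexwiseMaps.
Variables (k : fieldType) (Q : quiver).
Notation A := (path_algebra k Q).

(** These are the families of linear maps U_i -> V_i, U being the sum of the
    e_i U. *)
Definition vertexwise (U V : lmodType A) (h : U -> V) :=
  klinear h /\ forall i u, h (e_ i *: u) = e_ i *: h u.

Lemma vertexwise_x (U V : lmodType A) (g : U -> V) a u :
  vertexwise g -> g (x_ a *: u) = e_ (tgt a) *: g (x_ a *: u).
Proof.
move=> [_ ge]; rewrite -[RHS]ge.
by apply: (congr1 g); rewrite [RHS]scalerA tgt_x.
Qed.
End VertexwiseMaps.

(** * Kernels and free covers *)
Section KernelModules.
Variables (k : fieldType) (Q : quiver).
Notation A := (path_algebra k Q).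
Variables (U V : lmodType A) (f : {linear U -> V}).

Lemma val_ker (x : ker_mod f) : f (val x) = 0.
Proof. exact/eqP/(valP x). Qed.

Definition to_ker (u : U) (u0 : f u = 0) : ker_mod f :=
  exist (fun u => in_ker f u) u (introT eqP u0).

Lemma val_kerD (x y : ker_mod f) : val (x + y) = val x + val y.
Proof. exact: linearD. Qed.

Lemma val_kerZ (a : A) (x : ker_mod f) : val (a *: x) = a *: val x.
Proof. exact: linearZ. Qed.

Lemma val_ker_klinear c (x y : ker_mod f) :
  val (kscale c x + y) = kscale c (val x) + val y.
Proof. by rewrite val_kerD; congr (_ + _); apply: val_kerZ. Qed.
End KernelModules.

(** The universal property of the free cover of N, for maps to a vector space
    W on which the action of A need not be packaged as a module structure:
    [H n] is the orbit map of the prescribed image of the generator n. *)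
Section FreeCoverMaps.
Variables (k : fieldType) (Q : quiver).
Notation A := (path_algebra k Q).
Variables (N : lmodType A) (W : lmodType k).
Variable H : N -> A -> W.
Hypothesis H_linear : forall n, linear (H n).

Definition fc_fold (p : free_cover N) : W :=
  \sum_(n <- msupp p) H n (fc_coef p n).

Lemma fc_foldw (p : free_cover N) (D : {fset N}) :
  (msupp p `<=` D)%fset -> fc_fold p = \sum_(n <- D) H n (fc_coef p n).
Proof.
have H0 n : H n 0 = 0.
  apply: (addrI (H n 0)); rewrite addr0 -{2}[H n 0]scale1r addrC.
  by rewrite -H_linear scale1r addr0.
move=> sub; rewrite /fc_fold; apply: big_fset_incl => // n _ /mcoeff_outdom h.
by rewrite /fc_coef h H0.
Qed.

Lemma fc_coefZ a (p : free_cover N) n :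
  fc_coef (a *: p) n = a * fc_coef p n.
Proof. exact: fc_scaleE. Qed.

Lemma fc_coefD (p q : free_cover N) n :
  fc_coef (p + q) n = fc_coef p n + fc_coef q n.
Proof. exact: mcoeffD. Qed.

Lemma msupp_fcZ a (p : free_cover N) : (msupp (a *: p) `<=` msupp p)%fset.
Proof.
apply/fsubsetP => n; rewrite -!mcoeff_neq0 -/(fc_coef _ n) fc_coefZ.
by apply: contraNN => /eqP; rewrite /fc_coef => ->; rewrite mulr0.
Qed.

Lemma fc_fold_klinear c (p q : free_cover N) :
  fc_fold (kscale c p + q) = c *: fc_fold p + fc_fold q.
Proof.
pose D := (msupp p `|` msupp q)%fset.
rewrite (@fc_foldw p D) ?fsubsetUl // (@fc_foldw q D) ?fsubsetUr //.
rewrite (@fc_foldw _ D); last first.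
  by apply: fsubset_trans (msuppD_le _ _) _; apply/fsetSU/msupp_fcZ.
rewrite scaler_sumr -big_split /=; apply: eq_bigr => n _.
by rewrite fc_coefD fc_coefZ -pa_scalerAl mul1r H_linear.
Qed.

Lemma fc_fold_scale a (O : W -> W) : linear O ->
  (forall n b, H n (a * b) = O (H n b)) ->
  forall p, fc_fold (a *: p) = O (fc_fold p).
Proof.
move=> O_linear HO p; rewrite (fc_foldw (msupp_fcZ a p)) /fc_fold.
pose Ob := HB.pack_for {linear W -> W} O
  (GRing.isLinear.Build k W W _ O O_linear).
rewrite -[RHS]/(Ob _) linear_sum; apply: eq_bigr => n _.
by rewrite fc_coefZ HO.
Qed.
End FreeCoverMaps.

Section FreeCoverGenerators.
Variables (k : fieldType) (Q : quiver).
Notation A := (path_algebra k Q).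
Variable N : lmodType A.

Definition fc_gen (n : N) : free_cover N := (<< n >> : {malg A[N]}).

Lemma fc_proj_gen n : fc_proj (fc_gen n) = n.
Proof.
have E := @fc_foldw _ _ N (restr_scalars N) (fun n a => a *: n).
rewrite [LHS](E _ _ [fset n]%fset); last exact: msuppU_le.
  by rewrite big_seq_fset1 /fc_coef mcoeffUU scale1r.
by move=> m c a b; rewrite scalerDl kscaleZ.
Qed.
End FreeCoverGenerators.

(** * Extensions of modules and twisted maps *)
Section ArrowCochains.
Variables (k : fieldType) (Q : quiver).
Notation A := (path_algebra k Q).
Variables N M : lmodType A.
Implicit Types c : arrow Q -> N -> M.

(** The two equations say that [c a] lives on e_i N and takes values in e_j M
    for an arrow a : i -> j. *)
Definition cochain c := [/\ forall a, klinear (c a),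
  forall a n, c a (e_ (src a) *: n) = c a n
  & forall a n, e_ (tgt a) *: c a n = c a n].

(** The cochains of the extensions that split. *)
Definition coboundary c := exists2 h : N -> M, vertexwise h
  & forall a n, c a n = h (x_ a *: n) - x_ a *: h n.

(** The M-component of an A-linear lift P -> E of the projection P -> N, where E
    is the extension of N by M defined by c, that is, the vector space M + N on
    which an arrow a acts by x_a together with [c a] from N to M. *)
Definition twisted c (g : free_cover N -> M) := vertexwise g /\
  forall a p, g (x_ a *: p) = x_ a *: g p + c a (fc_proj p).

Section TwistedMap.
Variable c : arrow Q -> N -> M.
Hypothesis c_cochain : cochain c.

(** The extension E described above. *)
Definition ext_sum : lmodType k := (restr_scalars M * restr_scalars N)%type.
Definition ext_e (i : vertex Q) (w : ext_sum) : ext_sum :=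
  ((e_ i : A) *: (w.1 : M), (e_ i : A) *: (w.2 : N)).
Definition ext_x (a : arrow Q) (w : ext_sum) : ext_sum :=
  ((x_ a : A) *: (w.1 : M) + c a w.2, (x_ a : A) *: (w.2 : N)).

Fact ext_e_is_linear i : linear (ext_e i).
Proof.
by move=> b u v; congr pair; apply: scaler_klinear.
Qed.
HB.instance Definition _ i :=
  GRing.isLinear.Build k ext_sum ext_sum _ (ext_e i) (ext_e_is_linear i).

Fact ext_x_is_linear a : linear (ext_x a).
Proof.
have [ck _ _] := c_cochain.
move=> b u v; rewrite /ext_x; congr pair => /=.
  transitivity (kscale b ((x_ a : A) *: (u.1 : M)) + (x_ a : A) *: (v.1 : M)
                + (kscale b (c a u.2) + c a v.2)).
    by congr (_ + _); [apply: scaler_klinear | apply: ck].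
  by rewrite addrACA -kscaleDr.
exact: scaler_klinear.
Qed.
HB.instance Definition _ a :=
  GRing.isLinear.Build k ext_sum ext_sum _ (ext_x a) (ext_x_is_linear a).

Fact ext_e_orth i j w : ext_e i (ext_e j w) = if i == j then ext_e i w else 0.
Proof.
rewrite /ext_e /= !scalerA !e_mul; case: eqP => [->//|_].
by rewrite !scale0r.
Qed.

Fact ext_xe a w : ext_x a (ext_e (src a) w) = ext_x a w.
Proof.
have [_ cs _] := c_cochain.
congr pair; last by rewrite [LHS]scalerA x_src.
by congr (_ + _); [rewrite [LHS]scalerA x_src | apply: cs].
Qed.

Fact ext_ex a w : ext_e (tgt a) (ext_x a w) = ext_x a w.
Proof.
have [_ _ ct] := c_cochain.
congr pair; last by rewrite [LHS]scalerA tgt_x.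
by rewrite [LHS]scalerDr [X in X + _]scalerA tgt_x [X in _ + X]ct.
Qed.

Definition ext_act := pa_act (W := ext_sum) ext_e ext_x.

Lemma ext_actM b b' w : ext_act (b * b') w = ext_act b (ext_act b' w).
Proof. by rewrite [RHS]pa_actA //; [exact: ext_e_orth | exact: ext_ex]. Qed.

Lemma ext_act_e i w : ext_act (e_ i) w = ext_e i w.
Proof. by rewrite [LHS]pa_act_gen. Qed.

Lemma ext_act_x a w : ext_act (x_ a) w = ext_x a w.
Proof. by rewrite [LHS]pa_act_gen -[RHS]ext_xe. Qed.

Lemma ext_act2 b w : (ext_act b w).2 = b *: (w.2 : N).
Proof.
apply: (pa_lin_eq (W := restr_scalars N) (f := fun b => (ext_act b w).2)
         (g := fun b => b *: (w.2 : N))).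
- by move=> y u v; rewrite [ext_act _ _]pa_act_linl.
- by move=> y u v; rewrite scalerDl kscaleZ.
apply: (pgen_ind (P := fun b => (ext_act b w).2 = b *: (w.2 : N))) => [i|a p IH].
  by rewrite ext_act_e.
by rewrite ext_actM ext_act_x /= IH scalerA.
Qed.

(** Lifting each generator n of the free cover to (0, n). *)
Definition ext_lift := @fc_fold _ _ N ext_sum (fun n b => ext_act b (0, n)).

Fact ext_act_linear n : linear (fun b => ext_act b (0, n)).
Proof. exact: pa_act_linl. Qed.

Lemma ext_lift_scale b p : ext_lift (b *: p) = ext_act b (ext_lift p).
Proof.
apply: fc_fold_scale; first exact: ext_act_linear.
  exact: pa_act_linr.
by move=> n b'; apply: ext_actM.
Qed.

Lemma ext_lift2 p : (ext_lift p).2 = fc_proj p.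
Proof.
rewrite /ext_lift /fc_fold.
rewrite (big_morph (fun w : ext_sum => w.2 : N) (id1 := 0) (op1 := +%R)) //.
by apply: eq_bigr => n _; apply: ext_act2.
Qed.

Definition twisted_map p : M := (ext_lift p).1.

Lemma twisted_mapP : twisted c twisted_map.
Proof.
split; first split.
- move=> y p q; rewrite /twisted_map [ext_lift _]fc_fold_klinear //.
  exact: ext_act_linear.
- by move=> i p; rewrite /twisted_map ext_lift_scale ext_act_e.
by move=> a p; rewrite /twisted_map ext_lift_scale ext_act_x /= ext_lift2.
Qed.

End TwistedMap.
End ArrowCochains.

(** * Ext^1 as cochains modulo coboundaries *)
Section SyzygyMaps.
Variables (k : fieldType) (Q : quiver).
Notation A := (path_algebra k Q).
Variables N M : lmodType A.
Implicit Types c : arrow Q -> N -> M.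

Notation syzygy := (ker_mod (@fc_proj A N)).

Lemma twisted_comb c c' g g' y : twisted c g -> twisted c' g' ->
  twisted (fun a n => kscale y (c a n) + c' a n)
          (fun p => kscale y (g p) + g' p).
Proof.
move=> [[gk ge] gx] [[gk' ge'] gx']; split; first split.
- by move=> z p q; rewrite gk gk' !kscaleDr !kscaleA mulrC addrACA.
- by move=> i p; rewrite ge ge' scaler_klinear.
by move=> a p; rewrite gx gx' scaler_klinear kscaleDr addrACA.
Qed.

(** The defect of a twisted map only depends on the projection to N, which is
    zero on the kernel of the free cover. *)
Lemma twisted_linear c g :
  twisted c g -> cochain c -> linear (fun o : syzygy => g (val o)).
Proof.
move=> [[gk ge] gx] [ck _ _]; apply: klinear_linear.
- by move=> y o o'; rewrite /kscale !linearP gk.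
- by move=> i o; rewrite linearZ /= ge.
by move=> a o; rewrite linearZ /= gx val_ker (klinear0 (ck a)) addr0.
Qed.

(** The generator over n serves as a canonical preimage of n, so that passing
    to the quotient takes no choice. *)
Lemma factor_through_proj (V : lmodType A) (u : free_cover N -> V) :
  vertexwise u -> (forall o : syzygy, u (val o) = 0) ->
  vertexwise (fun n => u (fc_gen n)) /\
  (forall p, u p = u (fc_gen (fc_proj p))).
Proof.
move=> [uk ue] u0.
have uE p q : fc_proj p = fc_proj q -> u p = u q.
  move=> pq; have inO : fc_proj (p - q) = 0 by rewrite linearB /= pq subrr.
  have /eqP := u0 (to_ker inO).
  by rewrite (klinearB uk) subr_eq0 => /eqP.
split; last by move=> p; apply: uE; rewrite fc_proj_gen.
split=> [y m n|i n].
  rewrite -uk; apply: uE.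
  by rewrite fc_proj_gen linearD /= linear_kscale /= !fc_proj_gen.
by rewrite -ue; apply: uE; rewrite linearZ /= !fc_proj_gen.
Qed.

(** If psi extends the restriction of g, then g - psi vanishes on the kernel of
    the free cover and so comes from a map h on N, whose coboundary is c; if c
    is the coboundary of h, then g - h o fc_proj is an A-linear extension. *)
Lemma twisted_extends c g : twisted c g ->
  (exists psi : {linear free_cover N -> M},
     forall o : syzygy, g (val o) = psi (val o)) <-> coboundary c.
Proof.
move=> [[gk ge] gx]; split=> [[psi gpsi]|[h [hk he] hc]].
  pose u p := g p - psi p.
  have uv : vertexwise u.
    split=> [y p q|i p]; rewrite /u; last by rewrite ge linearZ /= -scalerBr.
    rewrite gk linearD /= linear_kscale /= kscaleDr kscaleN.
    by rewrite opprD addrACA.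
  have u0 (o : syzygy) : u (val o) = 0 by rewrite /u gpsi subrr.
  have [hv uE] := factor_through_proj uv u0.
  exists (fun n => u (fc_gen n)) => // a n.
  have := uE (x_ a *: fc_gen n); rewrite linearZ /= fc_proj_gen => <-.
  rewrite /u gx fc_proj_gen linearZ /= scalerBr.
  by rewrite opprB addrA subrK addrAC subrr add0r.
pose psi p := g p - h (fc_proj p).
have psi_linear : linear psi.
  apply: klinear_linear.
  - move=> y p q; rewrite /psi gk linearD /= linear_kscale /= hk.
    by rewrite opprD addrACA kscaleDr kscaleN.
  - by move=> i p; rewrite /psi ge linearZ /= he -scalerBr.
  move=> a p; rewrite /psi gx linearZ /= hc scalerBr.
  by rewrite addrAC addrA subrK.
pose psiL := GRing.isLinear.Build A (free_cover N) M _ psi psi_linear.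
exists (HB.pack_for {linear free_cover N -> M} psi psiL) => o /=.
by rewrite /psi val_ker (klinear0 hk) subr0.
Qed.

(** The k-linear section sigma splits P into O + sigma(N).  Extending phi by
    zero on sigma(N) gives g, and its failure to commute with an arrow a is
    n |-> phi (x_a sigma(n) - sigma(x_a n)). *)
Lemma syzygy_hom_twisted (sigma : N -> free_cover N) :
  vertexwise sigma -> (forall n, fc_proj (sigma n) = n) ->
  forall phi : {linear syzygy -> M}, exists c g,
    [/\ cochain c, twisted c g & forall o, phi o = g (val o)].
Proof.
move=> [sk se] sK phi.
have inO p : fc_proj (p - sigma (fc_proj p)) = 0.
  by rewrite linearB /= sK subrr.
(* The k-linear projection of P to O along sigma(N). *)
have [tau tauE] : exists tau : free_cover N -> syzygy,
    forall p, val (tau p) = p - sigma (fc_proj p).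
  by exists (fun p => to_ker (inO p)).
have tk : klinear tau.
  move=> y p q; apply: val_inj; rewrite [RHS]linearD linear_kscale /= !tauE.
  by rewrite linearD /= linear_kscale /= sk opprD addrACA kscaleDr kscaleN.
have te i p : tau (e_ i *: p) = e_ i *: tau p.
  by apply: val_inj; rewrite [RHS]linearZ /= !tauE linearZ /= se scalerBr.
(* As tau kills sigma(N), xi a n is x_a sigma(n) - sigma(x_a n). *)
have [xi xi_tau] : exists xi : arrow Q -> N -> syzygy,
    forall a n, xi a n = tau (x_ a *: sigma n).
  by exists (fun a n => tau (x_ a *: sigma n)).
have tx a p : tau (x_ a *: p) = x_ a *: tau p + xi a (fc_proj p).
  have e : fc_proj (x_ a *: sigma (fc_proj p)) = fc_proj (x_ a *: p).
    by rewrite [LHS]linearZ /= sK [RHS]linearZ.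
  have xiE : val (xi a (fc_proj p)) =
      x_ a *: sigma (fc_proj p) - sigma (fc_proj (x_ a *: p)).
    rewrite xi_tau; exact: etrans (tauE _) (congr1 (fun z => _ - sigma z) e).
  apply: val_inj; rewrite val_kerD val_kerZ xiE [LHS]tauE.
  rewrite [in X in _ = X + _]tauE scalerBr addrA subrK; reflexivity.
exists (fun a n => phi (xi a n)), (fun p => phi (tau p)); split.
- split=> [a y m n|a n|a n].
  + rewrite -linear_kscale -linearD !xi_tau sk scaler_klinear.
    by rewrite tk.
  + by rewrite !xi_tau se scalerA x_src.
  have e : e_ (tgt a) *: (x_ a *: sigma n) = x_ a *: sigma n.
    by rewrite [LHS]scalerA tgt_x.
  rewrite xi_tau -linearZ -te; exact: (congr1 (fun z => phi (tau z)) e).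
- split; first split.
  + by move=> y p q; rewrite tk linearD /= linear_kscale /=.
  + by move=> i p; rewrite te linearZ.
  by move=> a p; rewrite tx linearD linearZ.
move=> o; congr (phi _); apply: val_inj.
by rewrite tauE val_ker (klinear0 sk) subr0.
Qed.
End SyzygyMaps.

(** A basis of a complement of B gives a basis of the quotient by B. *)
Lemma compl_coord_uniq (k : fieldType) (Z : vectType k) (B : {vspace Z}) (z : Z) :
  exists! y : 'rV[k]_(\dim B^C), z - \sum_l y 0 l *: (vbasis B^C)`_l \in B.
Proof.
have : z \in (B + B^C)%VS by rewrite addv_complf memvf.
move=> /memv_addP[u uB [w wC zE]].
pose X := vbasis B^C.
have wE : w = \sum_l (\row_l coord X l w) 0 l *: X`_l.
  rewrite {1}(coord_vbasis wC); apply: eq_bigr => l _; by rewrite mxE.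
exists (\row_l coord X l w); split; first by rewrite -wE zE addrK.
move=> y yB; apply/rowP => l; rewrite mxE.
suff -> : w = \sum_l y 0 l *: X`_l.
  by rewrite coord_sum_free //; apply: basis_free (vbasisP _).
have inC : w - \sum_l y 0 l *: X`_l \in (B^C)%VS.
  rewrite rpredB // rpred_sum // => j _; rewrite rpredZ // vbasis_mem //.
  by rewrite mem_nth // size_tuple.
have inB : w - \sum_l y 0 l *: X`_l \in B.
  by rewrite -[w](addKr u) -zE -addrA rpredD // rpredN.
have : w - \sum_l y 0 l *: X`_l \in (B :&: B^C)%VS by rewrite memv_cap inB.
by rewrite capv_compl memv0 subr_eq0 => /eqP.
Qed.

(** Cochains are parametrized here by a finite-dimensional space Z, linearly
    and onto but not necessarily injectively: elements with the same cochain
    differ by an element of B, because the zero cochain is a coboundary. *)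
Section ExtByCochains.
Variables (k : fieldType) (Q : quiver).
Notation A := (path_algebra k Q).
Variables N M : lmodType A.
Variables (Z : vectType k) (B : {vspace Z}) (c : Z -> arrow Q -> N -> M).
Hypothesis c_cochain : forall z, cochain (c z).
Hypothesis c_linear : forall y z z' a n,
  c (y *: z + z') a n = kscale y (c z a n) + c z' a n.
Hypothesis c_surj : forall c' : arrow Q -> N -> M, cochain c' ->
  exists z, forall a n, c z a n = c' a n.
Hypothesis c_coboundary : forall z, coboundary (c z) <-> z \in B.
Variable sigma : N -> free_cover N.
Hypothesis sigma_vertexwise : vertexwise sigma.
Hypothesis sigmaK : forall n, fc_proj (sigma n) = n.

Notation syzygy := (ker_mod (@fc_proj A N)).

Lemma twisted_eq (c1 c2 : arrow Q -> N -> M) g1 g2 :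
  (forall a n, c1 a n = c2 a n) -> g1 =1 g2 ->
  twisted c1 g1 -> twisted c2 g2.
Proof.
move=> ec eg [[gk ge] gx]; split; first split.
- by move=> y p q; rewrite -!eg gk.
- by move=> i p; rewrite -!eg ge.
by move=> a p; rewrite -!eg gx ec.
Qed.

Lemma twisted_family_comb y z z' g g' : twisted (c z) g -> twisted (c z') g' ->
  twisted (c (y *: z + z')) (fun p => kscale y (g p) + g' p).
Proof.
by move=> tg tg'; apply: twisted_eq (twisted_comb y tg tg').
Qed.

Lemma twisted_zero : twisted (c 0) (fun=> 0).
Proof.
have c0 a n : c 0 a n = 0.
  apply: (addIr (c 0 a n)); rewrite add0r -{1}[c 0 a n]kscale1 -c_linear.
  by rewrite scaler0 addr0.
split; first split.
- by move=> y p q; rewrite kscaler0 addr0.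
- by move=> i p; rewrite scaler0.
by move=> a p; rewrite c0 scaler0 addr0.
Qed.

Lemma twisted_family_sum (I : Type) (r : seq I) (y : I -> k) (z : I -> Z) g :
  (forall l, twisted (c (z l)) (g l)) ->
  twisted (c (\sum_(l <- r) y l *: z l))
          (fun p => \sum_(l <- r) kscale (y l) (g l p)).
Proof.
move=> tg; elim: r => [|l r IH].
  by rewrite big_nil; apply: twisted_eq twisted_zero => // p; rewrite big_nil.
rewrite big_cons; apply: twisted_eq (twisted_family_comb (y l) (tg l) IH) => // p.
by rewrite big_cons.
Qed.

Theorem ext1_dim_of_cochains : ext1_dim N M (\dim B^C).
Proof.
pose b l : Z := (vbasis B^C)`_(l : 'I_(\dim B^C)).
(* The classes of the restrictions of the G l form the basis of Ext^1. *)
pose G l := twisted_map (c_cochain (b l)).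
have tG l : twisted (c (b l)) (G l) := twisted_mapP _.
pose ext_b l : {linear syzygy -> M} := HB.pack_for {linear syzygy -> M}
  (fun o : syzygy => G l (val o))
  (GRing.isLinear.Build A syzygy M _ (fun o : syzygy => G l (val o))
     (twisted_linear (tG l) (c_cochain (b l)))).
exists ext_b => phi.
have [c' [g [c'P tg gE]]] := syzygy_hom_twisted sigma_vertexwise sigmaK phi.
have [z zc'] := c_surj c'P.
have {c' c'P zc'}tg : twisted (c z) g by apply: twisted_eq tg.
have key (y : 'rV[k]_(\dim B^C)) :
    (exists psi : {linear free_cover N -> M}, forall x,
       phi x = \sum_(l < _) kscale (y 0 l) (ext_b l x) + psi (val x)) <->
    z - \sum_l y 0 l *: b l \in B.
  have ts := twisted_family_sum (index_enum _) (fun l => y 0 l) tG.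
  have td := twisted_family_comb (-1) ts tg.
  rewrite -c_coboundary addrC -scaleN1r.
  rewrite -(twisted_extends td).
  split=> -[psi psiE]; exists psi => o; have := psiE o; rewrite gE.
    move=> ->.
    by rewrite addrA -{2}[\sum_l _]kscale1 -kscaleDl addNr kscale0 add0r.
  move=> <-.
  by rewrite addrA -{1}[\sum_l _]kscale1 -kscaleDl subrr kscale0 add0r.
have [y [yB yU]] := compl_coord_uniq B z.
by exists y; split=> [|y' /key/yU]; first exact/key.
Qed.
End ExtByCochains.

(** * Linear maps from matrices to columns *)
Section Contraction.
Variables (k : fieldType) (n m s : nat).
Implicit Types (B : 'I_n -> 'M[k]_(m, s)) (X : 'M[k]_(n, s)).

(** A matrix X with rows X_l stands for the element sum_l rho_l (x) X_l of
    T_i (x) k^s.  If B_l is the matrix of v |-> phi (rho_l (x) v), this is the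
    value of phi on that element. *)
Definition contract B X : 'cV[k]_m := \sum_l B l *m (row l X)^T.

Lemma contract_linear B : linear (contract B).
Proof.
move=> y X Y; rewrite /contract scaler_sumr -big_split; apply: eq_bigr => l _ /=.
by rewrite !linearP.
Qed.
HB.instance Definition _ B :=
  GRing.isLinear.Build k 'M[k]_(n, s) 'cV[k]_m _ (contract B) (contract_linear B).

Lemma contract_linearl y B B' X :
  contract (fun l => y *: B l + B' l) X = y *: contract B X + contract B' X.
Proof.
rewrite /contract scaler_sumr -big_split; apply: eq_bigr => l _ /=.
by rewrite mulmxDl scalemxAl.
Qed.

Lemma contract_delta B l j : contract B (delta_mx l j) = col j (B l).
Proof.
rewrite /contract (bigD1 l) //= big1 => [|l' ne]; last first.
  rewrite (_ : row l' _ = 0) ?trmx0 ?mulmx0 //; apply/rowP => j'.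
  by rewrite !mxE (negPf ne).
rewrite addr0 (_ : row l _ = delta_mx 0 j) ?trmx_delta -?colE //.
by apply/rowP => j'; rewrite !mxE eqxx.
Qed.

Lemma eq_contract B B' :
  (forall X, contract B X = contract B' X) -> forall l, B l = B' l.
Proof.
move=> e l; apply/matrixP => r j.
by have /colP/(_ r) := e (delta_mx l j); rewrite !contract_delta !mxE.
Qed.

Definition mx_of_map (phi : 'M[k]_(n, s) -> 'cV[k]_m) (l : 'I_n) : 'M[k]_(m, s) :=
  \matrix_(r, j) phi (delta_mx l j) r 0.

Lemma mx_of_mapK phi : linear phi -> contract (mx_of_map phi) =1 phi.
Proof.
move=> phi_linear X.
pose phiL := HB.pack_for {linear 'M[k]_(n, s) -> 'cV[k]_m} phi
  (GRing.isLinear.Build k 'M[k]_(n, s) 'cV[k]_m _ phi phi_linear).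
rewrite -[RHS]/(phiL X) [X]matrix_sum_delta !linear_sum.
apply: eq_bigr => l _; rewrite !linear_sum; apply: eq_bigr => j _.
rewrite !linearZ /= contract_delta; congr (_ *: _).
by apply/colP => r; rewrite !mxE.
Qed.
End Contraction.

Lemma mulmx_of_linear (k : fieldType) n m (phi : 'cV[k]_n -> 'cV[k]_m) : linear phi ->
  forall x, (\matrix_(r, j) phi (delta_mx j 0) r 0) *m x = phi x.
Proof.
move=> phi_linear x.
pose phiL := HB.pack_for {linear 'cV[k]_n -> 'cV[k]_m} phi
  (GRing.isLinear.Build k 'cV[k]_n 'cV[k]_m _ phi phi_linear).
rewrite -[RHS]/(phiL x) [in RHS](matrix_sum_delta x) linear_sum.
apply/colP => r; rewrite !mxE summxE; apply: eq_bigr => j _.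
by rewrite big_ord1 linearZ /= !mxE mulrC.
Qed.

Lemma contract_mulmx (k : fieldType) n m m' s (C : 'M[k]_(m', m))
    (B : 'I_n -> 'M[k]_(m, s)) X :
  contract (fun l => C *m B l) X = C *m contract B X.
Proof.
by rewrite /contract mulmx_sumr; apply: eq_bigr => l _; rewrite mulmxA.
Qed.

(** The transpose of the action of an arrow on T_i, in coordinates: it turns the
    structure constants into the sum occurring in the relations. *)
Lemma contract_mull (k : fieldType) n n' m s (L : 'M[k]_(n, n'))
    (B : 'I_n -> 'M[k]_(m, s)) X :
  contract B (L *m X) = contract (fun l => \sum_r L r l *: B r) X.
Proof.
rewrite /contract; under [RHS]eq_bigr => l _.
  rewrite mulmx_suml; under eq_bigr => r _ do rewrite -scalemxAl scalemxAr; over.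
rewrite exchange_big; apply: eq_bigr => r _ /=; rewrite -mulmx_sumr.
congr (_ *m _); apply/colP => j; rewrite !mxE summxE.
by apply: eq_bigr => l _; rewrite !mxE.
Qed.

(** * Coordinates on the modules *)
Section RepModules.
Variables (k : fieldType) (Q : quiver) (d : vertex Q -> nat) (M : rep k d).
Notation A := (path_algebra k Q).
Implicit Types (u v : rep_mod M).

Definition rep_at u (i : vertex Q) : 'cV[k]_(d i) := dp_at u i.
Definition rep_in (i : vertex Q) (x : 'cV[k]_(d i)) : rep_mod M := vec_in x.

Lemma rep_mod_e i u : e_ i *: u = rep_in (rep_at u i).
Proof. exact: pa_act_gen. Qed.

Lemma rep_mod_x a u :
  x_ a *: u = rep_in (rep_fam M a *m rep_at u (src a)).
Proof.
have -> : x_ a *: u = rep_x M a (rep_e (src a) u) by exact: pa_act_gen.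
exact: rep_xe.
Qed.

Lemma rep_mod_kscale c u : kscale c u = (c *: (u : rep_space k d)).
Proof.
have E : pa_act (@rep_e k Q d) (rep_x M) (c *: (1 : A)) u
    = c *: pa_act (@rep_e k Q d) (rep_x M) 1 u by rewrite /pa_act linearZ.
apply: etrans E _; congr (_ *: _).
exact: (pa_act1 (rep_x M) (@rep_e_sum k Q d)).
Qed.

Lemma rep_at_klinear c u v i :
  rep_at (kscale c u + v) i = c *: rep_at u i + rep_at v i.
Proof. by rewrite rep_mod_kscale; apply: dp_atP. Qed.

Lemma rep_at0 i : rep_at 0 i = 0.
Proof. exact: dp_at0. Qed.

Lemma rep_in_klinear c i (x y : 'cV[k]_(d i)) :
  rep_in (c *: x + y) = kscale c (rep_in x) + rep_in y.
Proof. by rewrite rep_mod_kscale; apply: linearP. Qed.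

Lemma rep_inB i (x y : 'cV[k]_(d i)) :
  rep_in (x - y) = rep_in x - rep_in y.
Proof. exact: (linearB (@dp_inj k (vertex Q) (fun i => 'cV[k]_(d i)) i)). Qed.

Lemma rep_inK i (x : 'cV[k]_(d i)) : rep_at (rep_in x) i = x.
Proof. exact: dp_inj_id. Qed.

Lemma rep_in_ne i j (x : 'cV[k]_(d i)) : i != j -> rep_at (rep_in x) j = 0.
Proof. exact: dp_inj_ne. Qed.

Lemma rep_at_eq u v : (forall i, rep_at u i = rep_at v i) -> u = v.
Proof. exact: dpP. Qed.
End RepModules.

(** The vertex component (T (x) k^s)_i is identified with matrices by
    [tens_coord], with inverse [tens_of]. *)
Section TensorCoordinates.
Variables (k : fieldType) (Q : quiver).
Notation A := (path_algebra k Q).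
Variables (T : lmodType A) (t : vertex Q -> nat).
Variables (rho : forall i : vertex Q, 'I_(t i) -> T).
Hypothesis rho_basis : adapted_basis rho.
Variable s : nat.
Notation Ts := {ffun 'I_s -> T}.

Lemma rho_coord_ex i (x : T) :
  exists y : 'rV[k]_(t i), e_ i *: x == \sum_l kscale (y 0 l) (rho l).
Proof.
have [_ /(_ (e_ i *: x))] := rho_basis i.
rewrite scalerA e_mul eqxx => /(_ erefl)[y [yE _]].
by exists y; apply/eqP.
Qed.

Definition rho_coord i x : 'rV[k]_(t i) := xchoose (rho_coord_ex i x).

Lemma rho_coordE i x :
  e_ i *: x = \sum_l kscale (rho_coord i x 0 l) (rho l).
Proof. exact: (eqP (xchooseP (rho_coord_ex i x))). Qed.

Lemma rho_coord_uniq i (x : T) (y : 'rV[k]_(t i)) :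
  e_ i *: x = \sum_l kscale (y 0 l) (rho l) -> rho_coord i x = y.
Proof.
have [_ /(_ (e_ i *: x))] := rho_basis i.
rewrite scalerA e_mul eqxx => /(_ erefl)[z [_ zU]] yE.
by rewrite -(zU y yE); apply/esym/zU/rho_coordE.
Qed.

Lemma e_rho i (l : 'I_(t i)) : e_ i *: rho l = rho l.
Proof. by have [] := rho_basis i. Qed.

Definition tens_coord i (y : Ts) : 'M[k]_(t i, s) :=
  \matrix_(l, j) rho_coord i (y j) 0 l.

Definition tens_of i (X : 'M[k]_(t i, s)) : Ts :=
  [ffun j => \sum_l kscale (X l j) (rho l)].

Lemma tens_ofE i (X : 'M[k]_(t i, s)) j :
  tens_of X j = \sum_l kscale (X l j) (rho l).
Proof. exact: ffunE. Qed.

Lemma scale_ffunE (a : A) (y : Ts) j : (a *: y) j = a *: y j.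
Proof. exact: ffunE. Qed.

Lemma klinear_ffunE c (y z : Ts) j :
  (kscale c y + z) j = kscale c (y j) + z j.
Proof. by rewrite ffunE scale_ffunE. Qed.

Lemma tens_coordK i y : tens_of (tens_coord i y) = e_ i *: y.
Proof.
apply/ffunP => j; rewrite !ffunE rho_coordE.
by apply: eq_bigr => l _; rewrite mxE.
Qed.

Lemma e_tens_of i (X : 'M[k]_(t i, s)) : e_ i *: tens_of X = tens_of X.
Proof.
apply/ffunP => j; rewrite !ffunE scaler_sumr; apply: eq_bigr => l _.
by rewrite scaler_kscale e_rho.
Qed.

Lemma tens_ofK i (X : 'M[k]_(t i, s)) : tens_coord i (tens_of X) = X.
Proof.
apply/matrixP => l j; rewrite mxE (@rho_coord_uniq _ _ (\row_l X l j)) ?mxE //.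
have /ffunP/(_ j) := e_tens_of X; rewrite !ffunE => ->.
by apply: eq_bigr => l' _; rewrite mxE.
Qed.

Lemma tens_of_linear i c (X Y : 'M[k]_(t i, s)) :
  tens_of (c *: X + Y) = kscale c (tens_of X) + tens_of Y.
Proof.
apply/ffunP => j; rewrite klinear_ffunE; apply: etrans (tens_ofE _ _) _.
apply: etrans _ (congr2 (fun u v => kscale c u + v)
                   (esym (tens_ofE X j)) (esym (tens_ofE Y j))).
rewrite [X in _ = X + _]kscale_sum.
rewrite -big_split; apply: eq_bigr => l _ /=.
by rewrite [in LHS]mxE [in LHS]mxE kscaleDl kscaleA.
Qed.

Lemma tens_ofB i (X Y : 'M[k]_(t i, s)) :
  tens_of (X - Y) = tens_of X - tens_of Y.
Proof.
rewrite addrC -scaleN1r; apply: etrans (tens_of_linear _ _ _) _.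
by rewrite addrC /kscale !scaleN1r.
Qed.

Lemma tens_of_inj i : injective (@tens_of i).
Proof. exact: can_inj (@tens_ofK i). Qed.

Lemma tens_coord_klinear i c (y z : Ts) :
  tens_coord i (kscale c y + z) = c *: tens_coord i y + tens_coord i z.
Proof.
by apply: tens_of_inj; rewrite tens_of_linear !tens_coordK scaler_klinear.
Qed.

Lemma tens_coord_e i (y : Ts) : tens_coord i (e_ i *: y) = tens_coord i y.
Proof.
by apply: tens_of_inj; rewrite !tens_coordK scalerA e_mul eqxx.
Qed.

Lemma tens_of0 i : tens_of (0 : 'M_(t i, s)) = 0.
Proof.
by apply/ffunP => j; rewrite !ffunE big1 // => l _; rewrite mxE kscale0.
Qed.

Lemma e_tens_of_ne i j (X : 'M[k]_(t i, s)) : j != i -> e_ j *: tens_of X = 0.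
Proof.
by move=> ne; rewrite -e_tens_of scalerA e_mul (negPf ne) scale0r.
Qed.

Lemma tens_coord_e_ne i j (y : Ts) : i != j -> tens_coord i (e_ j *: y) = 0.
Proof.
move=> ne; apply: tens_of_inj.
by rewrite tens_coordK scalerA e_mul (negPf ne) scale0r tens_of0.
Qed.

Lemma tens_of_tens i (X : 'M[k]_(t i, s)) :
  tens_of X = \sum_l tens (rho l) (row l X)^T.
Proof.
apply/ffunP => j; rewrite ffunE sum_ffunE; apply: eq_bigr => l _.
by rewrite ffunE !mxE.
Qed.

Variables (lam : mxfamily k t) (lamP : structure_constants rho lam).

Lemma tens_coord_x a (y : Ts) :
  tens_coord (tgt a) (x_ a *: y) = lam a *m tens_coord (src a) y.
Proof.
apply: tens_of_inj; rewrite tens_coordK scalerA tgt_x -x_src -scalerA.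
apply: etrans (congr1 (fun z => x_ a *: z) (esym (tens_coordK _ y))) _.
apply/ffunP => j; rewrite scale_ffunE [RHS]tens_ofE tens_ofE [LHS]scaler_sumr.
under eq_bigr => l _ do rewrite scaler_kscale lamP kscale_sum.
rewrite exchange_big; apply: eq_bigr => m _ /=; rewrite mxE kscale_suml.
by apply: eq_bigr => l _; rewrite kscaleA mulrC.
Qed.
End TensorCoordinates.

(** * The linearized relations *)
Lemma dim_dprod (k : fieldType) (I : finType) (V : I -> vectType k) :
  \dim {: dprod V} = (\sum_i dim (V i))%N.
Proof.
rewrite dimvf [LHS](_ : _ = #|{: dp_index V}|) // card_tagged sumnE big_map.
by rewrite big_enum; apply: eq_bigr => i _; rewrite card_ord.
Qed.

Lemma dvd_Xn2_first_order (k : fieldType) (p q : k) :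
  ('X^2 %| 'X * p%:P + 'X^2 * q%:P) = (p == 0).
Proof.
rewrite dvdp_addl; last exact: dvdp_mulr.
rewrite exprS expr1 dvdp_mul2l ?polyX_eq0 //.
rewrite -[X in X %| _]subr0 -[0]/(0%:P) dvdp_XsubCl rootC //.
Qed.

Section LinearizedRelations.
Variables (k : fieldType) (Q : quiver) (t : vertex Q -> nat).
Variables (lam : mxfamily k t) (s : nat) (d : vertex Q -> nat).
Variable Mt : rep k (@hat_dim Q t s d).

Definition rel_space : vectType k :=
  dprod (fun x : {a : arrow Q & 'I_(t (src a))} => 'M[k]_(d (tgt (tag x)), s)).

(** The derivative of the relation at Mt in the direction v. *)
Definition drel (v : rep k (@hat_dim Q t s d)) (a : arrow Q)
    (l : 'I_(t (src a))) : 'M[k]_(d (tgt a), s) :=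
  old_mat (rep_fam Mt) a *m new_mat (rep_fam v) l
  + old_mat (rep_fam v) a *m new_mat (rep_fam Mt) l
  - \sum_m lam a m l *: new_mat (rep_fam v) m.

Definition rel_at (z : rel_space) (a : arrow Q) (l : 'I_(t (src a))) :
    'M[k]_(d (tgt a), s) :=
  dp_at z (Tagged (fun a => 'I_(t (src a))) l).

Definition drel_map (v : rep k (@hat_dim Q t s d)) : rel_space :=
  dp_of (fun x : {a : arrow Q & 'I_(t (src a))} => drel v (tagged x)).

Lemma rel_at_drel v a (l : 'I_(t (src a))) : rel_at (drel_map v) l = drel v l.
Proof. by rewrite /rel_at [LHS]dp_ofE. Qed.

Lemma rel_atP (z z' : rel_space) :
  (forall a (l : 'I_(t (src a))), rel_at z l = rel_at z' l) -> z = z'.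
Proof. by move=> e; apply: dpP => -[a l]; apply: e. Qed.

Lemma rel_at_linear y (z z' : rel_space) a (l : 'I_(t (src a))) :
  rel_at (y *: z + z') l = y *: rel_at z l + rel_at z' l.
Proof. by rewrite /rel_at dp_atP. Qed.

Lemma new_mat_linear c (u v : rep k (@hat_dim Q t s d)) i (l : 'I_(t i)) :
  new_mat (rep_fam (c *: u + v)) l
  = c *: new_mat (rep_fam u) l + new_mat (rep_fam v) l.
Proof. by rewrite /new_mat /rep_fam dp_atP. Qed.

Lemma old_mat_linear c (u v : rep k (@hat_dim Q t s d)) a :
  old_mat (rep_fam (c *: u + v)) a
  = c *: old_mat (rep_fam u) a + old_mat (rep_fam v) a.
Proof. by rewrite /old_mat /rep_fam dp_atP. Qed.

Lemma drel_map_linear : linear drel_map.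
Proof.
move=> c u v; apply: rel_atP => a l; rewrite rel_at_linear !rel_at_drel /drel.
rewrite new_mat_linear old_mat_linear mulmxDr mulmxDl -scalemxAr -scalemxAl.
under eq_bigr => m _ do rewrite new_mat_linear scalerDr scalerA mulrC -scalerA.
rewrite big_split /= -scaler_sumr !scalerDr scalerN opprD.
rewrite [X in X + (- _ - _)]addrACA [LHS]addrACA; reflexivity.
Qed.
HB.instance Definition _ := GRing.isLinear.Build k
  (rep k (@hat_dim Q t s d)) rel_space _ drel_map drel_map_linear.

(** The relation at Mt + X v has no constant term, since Mt satisfies it, and
    its coefficient of X is the derivative. *)
Lemma tangent_vectorE : in_Rep lam Mt ->
  forall v, tangent_vector lam Mt v <-> drel_map v = 0.
Proof.
move=> MtP v.
have relE a (l : 'I_(t (src a))) r c :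
    rel_mx (fun b => map_mx polyC (lam b)) (first_order Mt v) l r c
    = 'X * (drel v l r c)%:P
      + 'X^2 * ((old_mat (rep_fam v) a *m new_mat (rep_fam v) l) r c)%:P.
  pose mC m n (B : 'M[k]_(m, n)) := map_mx (@polyC k) B.
  have -> : rel_mx (fun b => map_mx polyC (lam b)) (first_order Mt v) l =
      mC _ _ (rel_mx lam (rep_fam Mt) l) + 'X *: mC _ _ (drel v l)
      + 'X^2 *: mC _ _ (old_mat (rep_fam v) a *m new_mat (rep_fam v) l).
    rewrite /rel_mx /drel /mC.
    rewrite [X in X *m _](_ : _ = mC _ _ (old_mat (rep_fam Mt) a)
                              + 'X *: mC _ _ (old_mat (rep_fam v) a)) //.
    rewrite [X in _ *m X](_ : _ = mC _ _ (new_mat (rep_fam Mt) l)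
                              + 'X *: mC _ _ (new_mat (rep_fam v) l)) //.
    rewrite [X in _ - X](_ : _ =
        mC _ _ (\sum_m lam a m l *: new_mat (rep_fam Mt) m)
        + 'X *: mC _ _ (\sum_m lam a m l *: new_mat (rep_fam v) m)); last first.
      rewrite /mC !map_mx_sum scaler_sumr -big_split; apply: eq_bigr => m _ /=.
      by rewrite !map_mxZ mxE scalerDr !scalerA mulrC.
    rewrite /mC !(map_mxB, map_mxD, map_mxM) mulmxDl !mulmxDr.
    rewrite -!scalemxAl -!scalemxAr scalerA -expr2 !scalerDr scalerN opprD.
    by rewrite !addrA [LHS](ACl (1 * 5 * 2 * 3 * 6 * 4))%AC.
  by rewrite (MtP a l) /mC map_mx0 add0r !mxE.
split=> [tv|v0 a l r c]; last first.
  by rewrite relE dvd_Xn2_first_order -rel_at_drel v0 [rel_at _ _]dp_ofE mxE.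
apply: rel_atP => a l; rewrite rel_at_drel [RHS]dp_ofE.
apply/matrixP => r c; rewrite [RHS]mxE; apply/eqP.
by have := tv a l r c; rewrite relE dvd_Xn2_first_order.
Qed.
End LinearizedRelations.

(** * The kernel of the structure map *)
Section KernelOfStructureMap.
Variables (k : fieldType) (Q : quiver).
Notation A := (path_algebra k Q).
Variables (T : lmodType A) (t : vertex Q -> nat).
Variables (rho : forall i : vertex Q, 'I_(t i) -> T).
Hypothesis rho_basis : adapted_basis rho.
Variables (lam : mxfamily k t) (lamP : structure_constants rho lam).
Variables (s : nat) (d : vertex Q -> nat).
Variable Mt : rep k (@hat_dim Q t s d).
Notation M := (rep_mod (rep_restr Mt)).
Notation Ts := {ffun 'I_s -> T}.
Variables (f : {linear Ts -> M}) (fP : structure_map rho f).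
Notation K := (ker_mod f).
Notation crd := (tens_coord rho_basis).

Lemma rep_restr_x a (u : M) :
  x_ a *: u = rep_in _ (old_mat (rep_fam Mt) a *m rep_at u (src a)).
Proof. by rewrite rep_mod_x /rep_fam [dp_at (rep_restr Mt) a]dp_ofE. Qed.

(** The map f_i from (T (x) k^s)_i to M_i, read in coordinates. *)
Definition f_at i : 'M[k]_(t i, s) -> 'cV[k]_(d i) :=
  contract (fun l => new_mat (rep_fam Mt) l).
HB.instance Definition _ i := GRing.Linear.on (@f_at i).

Lemma f_tens_of i (X : 'M[k]_(t i, s)) : f (tens_of rho X) = rep_in _ (f_at X).
Proof.
rewrite tens_of_tens linear_sum /=.
under eq_bigr => l _ do rewrite fP.
have e := linear_sum (@dp_inj k (vertex Q) (fun i => 'cV[k]_(d i)) i).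
by rewrite [RHS]e.
Qed.

Lemma rep_at_f i y : rep_at (f y) i = f_at (crd i y).
Proof.
have := f_tens_of (crd i y); rewrite tens_coordK linearZ /= rep_mod_e.
by move/(congr1 (fun u : M => rep_at u i)); rewrite !rep_inK.
Qed.

(** Any generalized inverse of f_i will do; it provides both the complement of
    ker f and the factorizations through f that are needed below. *)
Definition f_at_pinv i : 'cV[k]_(d i) -> 'M[k]_(t i, s) :=
  (linfun (@f_at i))^-1%VF.
HB.instance Definition _ i := GRing.Linear.on (@f_at_pinv i).

Lemma f_at_pinvK i (X : 'M[k]_(t i, s)) : f_at (f_at_pinv (f_at X)) = f_at X.
Proof.
have := limg_lfunVK (memv_img (linfun (@f_at i)) (memvf X)).
by rewrite !lfunE.
Qed.

Definition f_pinv (u : M) : Ts := \sum_i tens_of rho (f_at_pinv (rep_at u i)).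

Lemma e_f_pinv i u : e_ i *: f_pinv u = tens_of rho (f_at_pinv (rep_at u i)).
Proof.
rewrite /f_pinv scaler_sumr (bigD1 i) //= e_tens_of // big1 ?addr0 // => j ne.
by rewrite e_tens_of_ne // eq_sym.
Qed.

Lemma f_pinvK y : f (f_pinv (f y)) = f y.
Proof.
apply: eq_by_e => i; rewrite -linearZ e_f_pinv f_tens_of rep_mod_e.
by rewrite rep_at_f f_at_pinvK.
Qed.

Lemma f_pinv_vertexwise : vertexwise f_pinv.
Proof.
split=> [c u v|i u]; apply: eq_by_e => j.
  rewrite [LHS]e_f_pinv rep_at_klinear linearP tens_of_linear.
  by rewrite [RHS]scaler_klinear; congr (kscale _ _ + _); apply/esym/e_f_pinv.
rewrite scalerA e_mul e_f_pinv; have [->|ne] := eqVneq j i.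
  by rewrite e_f_pinv rep_mod_e rep_inK.
by rewrite scale0r rep_mod_e rep_in_ne 1?eq_sym // linear0 tens_of0.
Qed.

Fact ker_proj_subproof y : f (y - f_pinv (f y)) = 0.
Proof. by rewrite linearB /= f_pinvK subrr. Qed.

(** As f f_pinv f = f, this is a projection of T (x) k^s onto K: a k-linear map
    on K extends to T (x) k^s by composition with it. *)
Definition ker_proj (y : Ts) : K := to_ker (ker_proj_subproof y).

Lemma val_ker_proj y : val (ker_proj y) = y - f_pinv (f y).
Proof. by []. Qed.

Lemma ker_proj_vertexwise : vertexwise ker_proj.
Proof.
have [sk se] := f_pinv_vertexwise.
split=> [c y z|i y]; apply: val_inj.
  rewrite val_ker_klinear !val_ker_proj linearD /= linear_kscale /= sk.
  by rewrite opprD addrACA kscaleDr kscaleN.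
by rewrite val_kerZ !val_ker_proj linearZ /= se scalerBr.
Qed.

Lemma ker_projK (x : K) : ker_proj (val x) = x.
Proof.
apply: val_inj; rewrite val_ker_proj val_ker.
by rewrite (klinear0 f_pinv_vertexwise.1) subr0.
Qed.

(** The linear map of matrices that sends the elementary matrices to w. *)
Definition crd_sum (V : lmodType A) i (w : 'I_(t i) -> 'I_s -> V)
  (X : 'M[k]_(t i, s)) : V := \sum_l \sum_j kscale (X l j) (w l j).

Lemma crd_sum_linear (V : lmodType A) i (w : 'I_(t i) -> 'I_s -> V) c X Y :
  crd_sum w (c *: X + Y) = kscale c (crd_sum w X) + crd_sum w Y.
Proof.
rewrite /crd_sum kscale_sum -big_split; apply: eq_bigr => l _ /=.
rewrite kscale_sum -big_split; apply: eq_bigr => j _ /=.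
by rewrite [in LHS]mxE [in LHS]mxE kscaleDl kscaleA.
Qed.

Lemma crd_sum_delta i (X : 'M[k]_(t i, s)) :
  crd_sum (fun l j => tens_of rho (delta_mx l j)) X = tens_of rho X.
Proof.
have tD : {morph @tens_of k Q T t rho s i : X Y / X + Y}.
  by move=> X1 X2; rewrite -{1}[X1]scale1r tens_of_linear kscale1.
have tZ c Y : tens_of rho (c *: Y) = kscale c (@tens_of k Q T t rho s i Y).
  by rewrite -[c *: Y]addr0 tens_of_linear tens_of0 addr0.
rewrite {2}[X]matrix_sum_delta (big_morph _ tD (tens_of0 rho s i)).
apply: eq_bigr => l _; rewrite (big_morph _ tD (tens_of0 rho s i)).
by apply: eq_bigr => j _; rewrite tZ.
Qed.

Definition cover_lift i : 'M[k]_(t i, s) -> free_cover K :=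
  crd_sum (fun l j => fc_gen (ker_proj (tens_of rho (delta_mx l j)))).

(** K is spanned by the projections of the basis of T (x) k^s, and these may be
    sent to the corresponding generators; the idempotent e_i makes the section
    compatible with the vertices. *)
Definition cover_section (x : K) : free_cover K :=
  \sum_i e_ i *: cover_lift (crd i (val x)).

Lemma e_cover_section i x :
  e_ i *: cover_section x = e_ i *: cover_lift (crd i (val x)).
Proof. exact: e_sum_e. Qed.

Lemma cover_lift0 i : cover_lift (0 : 'M[k]_(t i, s)) = 0.
Proof.
by rewrite /cover_lift /crd_sum big1 // => l _; rewrite big1 // => j' _;
  rewrite mxE kscale0.
Qed.

Lemma cover_section_vertexwise : vertexwise cover_section.
Proof.
split=> [c x y|i x]; apply: eq_by_e => j.
  rewrite [LHS]e_cover_section val_ker_klinear tens_coord_klinear.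
  rewrite [cover_lift _]crd_sum_linear [LHS]scaler_klinear [RHS]scaler_klinear.
  exact: (congr2 (fun u v => kscale c u + v) (esym (e_cover_section j x))
                                             (esym (e_cover_section j y))).
rewrite [RHS]scalerA e_mul [LHS]e_cover_section; have [->|ne] := eqVneq j i.
  by rewrite e_cover_section val_kerZ tens_coord_e.
by rewrite [RHS]scale0r val_kerZ tens_coord_e_ne // cover_lift0 [LHS]scaler0.
Qed.

Lemma fc_proj_lift_ker i (X : 'M[k]_(t i, s)) :
  fc_proj (cover_lift X) = ker_proj (tens_of rho X).
Proof.
have [pk _] := ker_proj_vertexwise.
rewrite /cover_lift /crd_sum linear_sum -crd_sum_delta /crd_sum (klinear_sum pk).
apply: eq_bigr => l _; rewrite linear_sum (klinear_sum pk).
by apply: eq_bigr => j _; rewrite linear_kscale /= fc_proj_gen (klinearZ pk).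
Qed.

Lemma fc_proj_cover_section x : fc_proj (cover_section x) = x.
Proof.
have [pk pe] := ker_proj_vertexwise.
apply: eq_by_e => i; rewrite -linearZ e_cover_section linearZ /= fc_proj_lift_ker.
by rewrite tens_coordK pe ker_projK scalerA e_mul eqxx.
Qed.

Lemma coboundaryE (h : K -> M) a x : vertexwise h ->
  h (x_ a *: x) - x_ a *: h x =
  rep_in _ (rep_at (h (x_ a *: x)) (tgt a)
            - old_mat (rep_fam Mt) a *m rep_at (h x) (src a)).
Proof.
move=> hv; apply: etrans _ (esym (rep_inB _ _ _)).
have e1 := etrans (vertexwise_x a x hv) (rep_mod_e _ _).
exact: (congr2 (fun u v : M => u - v) e1 (rep_restr_x a (h x))).
Qed.

(** The linear maps encoded by z, restricted to K. *)
Definition rel_cochain (z : rel_space k t s d) (a : arrow Q) (x : K) : M :=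
  rep_in _ (contract (rel_at z (a := a)) (crd (src a) (val x))).

Lemma rel_cochainP z : cochain (rel_cochain z).
Proof.
split=> [a c x y|a x|a x].
- rewrite /rel_cochain val_ker_klinear tens_coord_klinear linearP.
  exact: rep_in_klinear.
- by rewrite /rel_cochain val_kerZ tens_coord_e.
by rewrite rep_mod_e rep_inK.
Qed.

Lemma rel_cochain_linear c z z' a x :
  rel_cochain (c *: z + z') a x
  = kscale c (rel_cochain z a x) + rel_cochain z' a x.
Proof.
rewrite /rel_cochain -rep_in_klinear -contract_linearl; congr rep_in.
by apply: eq_bigr => l _; rewrite rel_at_linear.
Qed.

(** The vertex component at i of the extension of g to T (x) k^s. *)
Definition tens_map (g : K -> M) i (X : 'M[k]_(t i, s)) : 'cV[k]_(d i) :=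
  rep_at (g (ker_proj (tens_of rho X))) i.

Lemma tens_map_linear (g : K -> M) i : klinear g -> linear (@tens_map g i).
Proof.
have [pk _] := ker_proj_vertexwise.
by move=> gk c X Y; rewrite /tens_map tens_of_linear pk gk rep_at_klinear.
Qed.

Lemma tens_map_crd (g : K -> M) i x :
  vertexwise g -> tens_map g (crd i (val x)) = rep_at (g x) i.
Proof.
have [_ pe] := ker_proj_vertexwise; move=> [_ ge].
by rewrite /tens_map tens_coordK pe ker_projK ge rep_mod_e rep_inK.
Qed.

Lemma rel_cochain_surj c : cochain c ->
  exists z, forall a x, rel_cochain z a x = c a x.
Proof.
move=> [ck cs ct].
pose F (y : {a : arrow Q & 'I_(t (src a))}) : 'M[k]_(d (tgt (tag y)), s) :=
  mx_of_map (fun X => rep_at (c (tag y) (ker_proj (tens_of rho X))) (tgt (tag y)))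
    (tagged y).
exists (dp_of F) => a x.
have lin : linear (fun X : 'M[k]_(t (src a), s) =>
    rep_at (c a (ker_proj (tens_of rho X))) (tgt a)).
  have [pk _] := ker_proj_vertexwise.
  by move=> b X Y; rewrite tens_of_linear pk ck rep_at_klinear.
rewrite -ct rep_mod_e /rel_cochain; congr rep_in.
rewrite -[in RHS]cs.
have [_ pe] := ker_proj_vertexwise.
rewrite -[in RHS](ker_projK x) -pe -(tens_coordK rho_basis (src a) (val x)).
rewrite -[RHS](mx_of_mapK lin); apply: eq_bigr => l _.
by congr (_ *m _); rewrite /rel_at [LHS]dp_ofE.
Qed.

Lemma contract_drel v a (X : 'M[k]_(t (src a), s)) :
  contract (rel_at (drel_map lam Mt v) (a := a)) X
  = old_mat (rep_fam Mt) a *m contract (new_mat (rep_fam v) (i := src a)) X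
    + old_mat (rep_fam v) a *m f_at X
    - contract (new_mat (rep_fam v) (i := tgt a)) (lam a *m X).
Proof.
rewrite contract_mull -!contract_mulmx /contract -big_split -sumrB /=.
by apply: eq_bigr => l _; rewrite rel_at_drel /drel mulmxBl mulmxDl.
Qed.

(** On K the terms that contain f vanish; the remaining ones are the coboundary
    of minus the map T (x) k^s -> M given by the new arrows of v. *)
Lemma drel_coboundary v : coboundary (rel_cochain (drel_map lam Mt v)).
Proof.
pose h (x : K) : M :=
  dp_of (fun i => - contract (new_mat (rep_fam v) (i := i)) (crd i (val x))).
have h_at x i : rep_at (h x) i
    = - contract (new_mat (rep_fam v) (i := i)) (crd i (val x)).
  exact: dp_ofE.
have hv : vertexwise h.
  split=> [c x y|i x]; apply: rep_at_eq => j.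
    rewrite rep_at_klinear !h_at val_ker_klinear tens_coord_klinear linearP.
    by rewrite opprD scalerN.
  rewrite rep_mod_e h_at val_kerZ; have [->|ne] := eqVneq i j.
    by rewrite rep_inK h_at tens_coord_e.
  by rewrite rep_in_ne // tens_coord_e_ne 1?eq_sym // linear0 oppr0.
exists h => // a x; rewrite coboundaryE //.
rewrite /rel_cochain contract_drel -rep_at_f val_ker rep_at0 mulmx0 addr0.
by rewrite !h_at val_kerZ (tens_coord_x _ lamP) mulmxN opprK addrC.
Qed.

Lemma f_pinv_in i (m : 'cV[k]_(d i)) :
  f_pinv (rep_in _ m) = tens_of rho (f_at_pinv m).
Proof.
rewrite /f_pinv (bigD1 i) //= rep_inK big1 => [|j ne]; first exact: addr0.
by rewrite rep_in_ne 1?eq_sym // linear0 tens_of0.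
Qed.

Lemma ker_proj_tens_of i (X : 'M[k]_(t i, s)) :
  val (ker_proj (tens_of rho X)) = tens_of rho (X - f_at_pinv (f_at X)).
Proof.
by rewrite val_ker_proj f_tens_of f_pinv_in; exact: esym (tens_ofB _ _ _).
Qed.

(** Conversely, let the cochain of z be the coboundary of h.  Extending -h to
    T (x) k^s gives the new arrows of v.  After subtracting their contribution,
    z vanishes on K, hence factors through f, and the factor gives the old
    arrows. *)
Lemma coboundary_is_drel z : coboundary (rel_cochain z) ->
  exists v, z = drel_map lam Mt v.
Proof.
move=> [h hv hz].
pose w i (l : 'I_(t i)) : 'M[k]_(d i, s) := - mx_of_map (tens_map h (i := i)) l.
have wE i X : contract (@w i) X = - tens_map h X.
  rewrite -(mx_of_mapK (tens_map_linear hv.1)) /contract -sumrN.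
  by apply: eq_bigr => l _; rewrite mulNmx.
pose zeta a (X : 'M[k]_(t (src a), s)) : 'cV[k]_(d (tgt a)) :=
  contract (rel_at z (a := a)) X
  - (old_mat (rep_fam Mt) a *m contract (@w (src a)) X
     - contract (@w (tgt a)) (lam a *m X)).
have zeta_linear a : linear (@zeta a).
  move=> c X Y; rewrite /zeta !linearP /=.
  rewrite !(opprD, opprK, scalerDr, scalerN) !addrA.
  by rewrite [LHS](ACl (1 * 3 * 5 * 2 * 4 * 6))%AC.
have zeta_ker a (x : K) : zeta a (crd (src a) (val x)) = 0.
  have ex : lam a *m crd (src a) (val x) = crd (tgt a) (val (x_ a *: x)).
    by rewrite val_kerZ (tens_coord_x _ lamP).
  have ez : contract (rel_at z (a := a)) (crd (src a) (val x))
      = rep_at (h (x_ a *: x)) (tgt a)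
        - old_mat (rep_fam Mt) a *m rep_at (h x) (src a).
    have := congr1 (fun u : M => rep_at u (tgt a)) (hz a x).
    by rewrite coboundaryE // !rep_inK.
  rewrite /zeta ez ex !wE !tens_map_crd //.
  by rewrite mulmxN opprK [- _ + _]addrC subrr.
(* X and its image differ by an element of K. *)
have zeta_inv a X : zeta a (f_at_pinv (f_at X)) = zeta a X.
  have := zeta_ker a (ker_proj (tens_of rho X)).
  rewrite ker_proj_tens_of tens_ofK => zeta0.
  have := zeta_linear a (-1) (f_at_pinv (f_at X)) X.
  rewrite !scaleN1r [- f_at_pinv _ + _]addrC zeta0 [- zeta a _ + _]addrC.
  by move/esym/eqP; rewrite subr_eq0 => /eqP.
pose vo a : 'M[k]_(d (tgt a), d (src a)) :=
  \matrix_(r, j) zeta a (f_at_pinv (delta_mx j 0)) r 0.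
have voE a m : vo a *m m = zeta a (f_at_pinv m).
  apply: (mulmx_of_linear (phi := fun m => zeta a (f_at_pinv m))) => c m1 m2.
  by rewrite linearP zeta_linear.
pose F (b : arrow (hat_quiver t)) :
    'M[k]_(hat_dim s d (tgt b), hat_dim s d (src b)) :=
  match b with
  | inl a => vo a
  | inr il => w (tag il) (tagged il)
  end.
exists (dp_of F); apply: rel_atP => a; apply: eq_contract => X.
have vn i Y : contract (new_mat (rep_fam (dp_of F)) (i := i)) Y
    = contract (@w i) Y.
  by apply: eq_bigr => l _; rewrite /new_mat /rep_fam dp_ofE.
have -> : contract (rel_at (drel_map lam Mt (dp_of F)) (a := a)) X
  = old_mat (rep_fam Mt) a *m contract (@w (src a)) X
    + vo a *m f_at X - contract (@w (tgt a)) (lam a *m X).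
  rewrite contract_drel !vn; congr (_ + _ *m _ - _).
  by rewrite /old_mat /rep_fam dp_ofE.
rewrite voE zeta_inv /zeta opprB !addrA.
by rewrite [RHS](ACl (2 * 1 * 4 * 3 * 5))%AC /= addrK addrK.
Qed.
End KernelOfStructureMap.

(** * Dimensions and conclusion *)
Lemma dim_rep (k : fieldType) (Q : quiver) (d : vertex Q -> nat) :
  \dim {: rep k d} = (\sum_a d (tgt a) * d (src a))%N.
Proof. exact: dim_dprod. Qed.

Lemma dim_rep_hat (k : fieldType) (Q : quiver) (t : vertex Q -> nat)
    (s : nat) (d : vertex Q -> nat) :
  \dim {: rep k (@hat_dim Q t s d)}
  = (\dim {: rep k d} + s * \sum_i t i * d i)%N.
Proof.
rewrite !dim_rep big_sumType /=; congr (_ + _)%N.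
rewrite -(sig_big_dep predT (fun _ => predT) (fun i _ => d i * s)%N) big_distrr /=.
by apply: eq_bigr => i _; rewrite sum_nat_const card_ord mulnA mulnC.
Qed.

Lemma dim_rel_space (k : fieldType) (Q : quiver) (t : vertex Q -> nat)
    (s : nat) (d : vertex Q -> nat) :
  \dim {: rel_space k t s d} = (s * \sum_a t (src a) * d (tgt a))%N.
Proof.
rewrite dim_dprod /=.
rewrite -(sig_big_dep predT (fun _ => predT) (fun a _ => d (tgt a) * s)%N) big_distrr /=.
by apply: eq_bigr => a _; rewrite sum_nat_const card_ord mulnA mulnC.
Qed.

Lemma euler_formE (Q : quiver) (t d : vertex Q -> nat) :
  euler_form t d = (\sum_i t i * d i)%N%:Z - (\sum_a t (src a) * d (tgt a))%N%:Z.
Proof. by rewrite /euler_form !(big_morph Posz PoszD (erefl _)). Qed.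

Theorem theorem4p1 (k : closedFieldType) (Q : quiver)
  (T : lmodType (path_algebra k Q)) (t : vertex Q -> nat)
  (rho : forall i : vertex Q, 'I_(t i) -> T) (rho_basis : adapted_basis rho)
  (lam : mxfamily k t) (lamP : structure_constants rho lam)
  (s : nat) (d : vertex Q -> nat)
  (Mt : rep k (@hat_dim Q t s d)) (MtP : in_Rep lam Mt)
  (f : {linear {ffun 'I_s -> T} -> rep_mod (rep_restr Mt)})
  (fP : structure_map rho f) :
  exists (U : {vspace rep k (@hat_dim Q t s d)}) (e : nat),
    [/\ tangent_space lam Mt U,
        ext1_dim (ker_mod f) (rep_mod (rep_restr Mt)) e
      & (\dim U)%:Z
        = (\dim {: rep k d})%:Z + s%:Z * euler_form t d + e%:Z ].
Proof.
pose Phi := linfun (drel_map lam Mt).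
exists (lker Phi), (\dim (limg Phi)^C); split.
- move=> v; rewrite memv_ker lfunE tangent_vectorE //.
  by split=> /eqP.
- apply: (@ext1_dim_of_cochains _ _ _ _ _ _ (rel_cochain rho_basis (f := f))).
  + exact: rel_cochainP.
  + exact: rel_cochain_linear.
  + exact: rel_cochain_surj.
  + move=> z; split=> [/(coboundary_is_drel lamP fP)[v ->]|/memv_imgP[v _ ->]].
      by rewrite -lfunE memv_img ?memvf.
    by rewrite lfunE; apply: drel_coboundary.
  + exact: cover_section_vertexwise fP.
  exact: fc_proj_cover_section.
rewrite dimv_compl dim_rel_space euler_formE.
have := limg_ker_dim Phi fullv; rewrite capfv dim_rep_hat => rank_nullity.
have : (\dim (limg Phi) <= \dim {: rel_space k t s d})%N by rewrite dimvS ?subvf.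
rewrite dim_rel_space => le.
rewrite -subzn // mulrBr -!PoszM.
apply: (addIr (\dim (limg Phi))%:Z); rewrite -PoszD rank_nullity PoszD.
by rewrite !addrA addrNK subrK.
Qed.
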